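(* Let $\mathsf{H}$ be a pseudovariety of groups and suppose that $\sigma_0$ is an implicit signature such that the $\mathsf{H}$-pointlike problem is $\sigma_0$-reducible. Let $\mathsf{V}=\mathsf{DO}\cap\overline{\mathsf{H}}$ and let $\sigma=\sigma_0\cup\{\_^\omega\}$. Suppose that $S$ is a finite semigroup, $A$ is a finite set, $\varphi:\overline{\Omega}_A\mathsf{S}\to S$ is an onto continuous homomorphism, and $\{s_1,\ldots,s_n\}$ is a $\mathsf{V}$-pointlike subset of $S$. Given $u_1,\ldots,u_n\in\overline{\Omega}_A\mathsf{S}$ such that $\varphi(u_i)=s_i$ ($i=1,\ldots,n$) and $$p_{\mathsf{V}}(u_1)=\cdots=p_{\mathsf{V}}(u_n),$$ there exist $w_1,\ldots,w_n\in\Omega^\sigma_A\mathsf{S}$ such that $$\varphi(w_i)=s_i\ (i=1,\ldots,n)\quad\text{and}\quad p_{\mathsf{V}}(w_1)=\cdots=p_{\mathsf{V}}(w_n).$$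
   Context: $\mathsf{S}$ is the pseudovariety of all finite semigroups, and for a finite set $A$, $\overline{\Omega}_A\mathsf{S}$ is the free profinite semigroup on $A$; its elements are called pseudowords. For a pseudovariety $\mathsf{V}$ of semigroups, $\overline{\Omega}_A\mathsf{V}$ is the free pro-$\mathsf{V}$ semigroup on $A$ and $p_{\mathsf{V}}:\overline{\Omega}_A\mathsf{S}\to\overline{\Omega}_A\mathsf{V}$ is the canonical projection. $\mathsf{DO}$ is the pseudovariety of all finite semigroups in which every regular $\mathcal{J}$-class is a subsemigroup isomorphic to a direct product of a rectangular band and a group. For a pseudovariety $\mathsf{H}$ of groups, $\overline{\mathsf{H}}$ is the pseudovariety of all finite semigroups all of whose subgroups lie in $\mathsf{H}$. So $\mathsf{DO}\cap\overline{\mathsf{H}}$ consists of all finite semigroups in which every regular $\mathcal{J}$-class is the product of a rectangular band by a group from $\mathsf{H}$. An implicit signature is a set $\sigma$ of pseudowords (elements of finitely generated free profinite semigroups, viewed as implicit operations) that contains binary multiplication. Pseudowords have a natural interpretation as operations on every profinite semigroup, so every profinite semigroup is a $\sigma$-algebra; $\Omega^\sigma_A\mathsf{S}$ is the $\sigma$-subalgebra of $\overline{\Omega}_A\mathsf{S}$ generated by $A$. The operation $\_^\omega$ is the unary operation which in a finite semigroup maps $x$ to its unique idempotent power $x^\omega$. A nonempty subset $P$ of a finite semigroup $S$ is $\mathsf{V}$-pointlike if for every finite set $A$ and every onto continuous homomorphism $\varphi:\overline{\Omega}_A\mathsf{S}\to S$ there is a subset $P'\subseteq\overline{\Omega}_A\mathsf{S}$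 such that $\varphi(P')=P$ and $p_{\mathsf{V}}(P')$ is a singleton. The $\mathsf{V}$-pointlike problem is $\sigma$-reducible if, for every finite semigroup $S$, every $\mathsf{V}$-pointlike subset $P$ of $S$ and every such $\varphi$, the set $P'$ can be chosen to be a subset of $\Omega^\sigma_A\mathsf{S}$. *)

(* Defs.v *)
From HB Require Import structures.
From mathcomp Require Import all_boot all_classical.
From mathcomp Require Import zify.
From mathcomp Require Import topology separation_axioms function_spaces.

Set Implicit Arguments.
Unset Strict Implicit.
Unset Printing Implicit Defensive.

Local Open Scope classical_set_scope.

#[short(type="finSemigroupType")]
HB.structure Definition FinSemigroup := {S of Finite S & Semigroup S}.

HB.saturate prod.

Definition semigroup_class := finSemigroupType -> Prop.

(* The carrier of a [finSemigroupType] may be empty. The condition [0 < #|T|]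
   excludes the empty subsemigroup, so that classes of groups qualify; whether
   or not a pseudovariety contains the empty semigroup is irrelevant below. *)
Record pseudovariety (V : semigroup_class) : Prop := {
  pv_trivial : forall S : finSemigroupType, #|S| = 1%N -> V S;
  pv_prod : forall S T : finSemigroupType, V S -> V T -> V (S * T)%type;
  pv_sub : forall (S T : finSemigroupType) (f : {multiplicative T -> S}),
    (0 < #|T|)%N -> injective f -> V S -> V T;
  pv_quo : forall (S T : finSemigroupType) (f : {multiplicative S -> T}),
    (forall t, exists s, f s = t) -> V S -> V T }.

Definition all_semigroups : semigroup_class := fun=> True.

Lemma pseudovariety_all : pseudovariety all_semigroups.
Proof. by []. Qed.

Definition is_group (S : semigroupType) : Prop :=
  exists2 e : S, (forall x, (e * x = x /\ x * e = x)%g) &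
    forall x, exists y, (y * x = e /\ x * y = e)%g.

Definition pseudovariety_of_groups (H : semigroup_class) : Prop :=
  pseudovariety H /\ forall S, H S -> is_group S.

Definition rectangular_band (S : semigroupType) : Prop :=
  forall x y : S, (x * x = x /\ x * y * x = x)%g.

Section GreenJ.
Context {S : semigroupType}.

(* [x \in S^1 y S^1], spelled out since [S] need not have an identity. *)
Definition J_le (x y : S) : Prop :=
  [\/ x = y, exists s, x = (s * y)%g, exists t, x = (y * t)%g
    | exists s t, x = (s * y * t)%g].

Definition J_class (x : S) : set S := [set y | J_le x y /\ J_le y x].

Definition regular_elt (x : S) : Prop := exists y, (x * y * x)%g = x.

Definition regular_J_class (J : set S) : Prop :=
  exists2 x, regular_elt x & J = J_class x.

End GreenJ.

Definition DO : semigroup_class := fun S =>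
  forall J : set S, regular_J_class J ->
  exists (B G : finSemigroupType) (f : {multiplicative (B * G)%type -> S}),
    [/\ rectangular_band B, is_group G, injective f & range f = J].

(* Subgroups of [S] are represented by the embeddings of groups into [S]. *)
Definition groups_in (H : semigroup_class) : semigroup_class := fun S =>
  forall (G : finSemigroupType) (f : {multiplicative G -> S}),
    is_group G -> injective f -> H G.

Definition DO_inter (H : semigroup_class) : semigroup_class := fun S =>
  DO S /\ groups_in H S.

HB.mixin Record isTopSemigroup S of Topological S & Semigroup S := {
  mulg_continuous : continuous (fun xy : S * S => (xy.1 * xy.2)%g) }.

#[short(type="topSemigroupType")]
HB.structure Definition TopSemigroup :=
  {S of Topological S & Semigroup S & isTopSemigroup S}.

Definition residually (V : semigroup_class) (T : topSemigroupType) : Prop :=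
  forall x y : T, x <> y ->
  exists (S : finSemigroupType) (f : {multiplicative T -> S}),
    [/\ V S, continuous (f : T -> discrete_topology S) & f x <> f y].

Definition pro (V : semigroup_class) (T : topSemigroupType) : Prop :=
  [/\ compact [set: T], hausdorff_space T & residually V T].

(* [finSemigroupType] lies in a universe too large to index a projective limit
   that is again a [choiceType], so the limit below ranges over the finite
   semigroups with carrier ['I_n]. Every finite semigroup is isomorphic to one
   of them ([optable_of]). *)

Record optable := OpTable {
  table_size : nat;
  opmul : 'I_table_size -> 'I_table_size -> 'I_table_size;
  opmulA : associative opmul }.

Definition opsort (t : optable) : Type := 'I_(table_size t).
Coercion opsort : optable >-> Sortclass.

HB.instance Definition _ (t : optable) :=
  Finite.copy (opsort t) 'I_(table_size t).
HB.instance Definition _ (t : optable) :=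
  isSemigroup.Build (opsort t) (@opmulA t).

Lemma trivial_mulA : associative (fun x y : 'I_1 => x). Proof. by []. Qed.

Definition trivial_table : optable := OpTable trivial_mulA.

Section OptableOf.
Variable S : finSemigroupType.

Definition rank_mul (i j : 'I_#|S|) : 'I_#|S| :=
  enum_rank (enum_val i * enum_val j)%g.

Lemma rank_mulA : associative rank_mul.
Proof. by move=> i j k; rewrite /rank_mul !enum_rankK mulgA. Qed.

Definition optable_of : optable := OpTable rank_mulA.

Definition to_table (x : S) : optable_of := enum_rank x.
Definition of_table (i : optable_of) : S := enum_val (i : 'I_#|S|).

Lemma to_tableK : cancel to_table of_table.
Proof. exact: enum_rankK. Qed.

Lemma of_tableK : cancel of_table to_table.
Proof. exact: enum_valK. Qed.

Lemma of_table_mul : {morph of_table : x y / (x * y)%g}.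
Proof. by move=> x y; exact: enum_rankK. Qed.

Lemma to_table_mul : {morph to_table : x y / (x * y)%g}.
Proof.
by move=> x y; apply: (can_inj of_tableK); rewrite of_table_mul !to_tableK.
Qed.

HB.instance Definition _ := isMultiplicative.Build _ _ of_table of_table_mul.
HB.instance Definition _ := isMultiplicative.Build _ _ to_table to_table_mul.

Lemma pv_optable_of (V : semigroup_class) :
  pseudovariety V -> V S -> V optable_of.
Proof.
move=> pV; apply: (pv_quo pV (f := to_table)) => t.
by exists (of_table t); exact: of_tableK.
Qed.

End OptableOf.

(* The free pro-V semigroup on [A], constructed as the projective limit of the
   members [S] of [V] labelled by a map [A -> S], along the homomorphisms that
   respect the labels; equivalently, as the set of [A]-ary implicit operations
   on [V]. [Omega_pro] and [Omega_free] show that it is pro-V and has the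
   universal property. *)

Section Omega.
Variables (V : semigroup_class) (A : finType).

Record labelled := Label {
  target : optable;
  targetV : V target;
  label : A -> target }.

Definition compatible (w : forall i : labelled, target i) : Prop :=
  forall (i j : labelled) (h : {multiplicative target i -> target j}),
    (forall a, h (label i a) = label j a) -> h (w i) = w j.

Record Omega := MkOmega {
  Omega_coord :> forall i : labelled, target i;
  Omega_coordP : compatible Omega_coord }.

Lemma Omega_eq (v w : Omega) : (forall i, v i = w i) -> v = w.
Proof.
case: v w => [v cv] [w cw] /= vw.
have E : v = w by apply: functional_extensionality_dep.
by move: cv cw; rewrite E => cv cw; congr MkOmega; exact: Prop_irrelevance.
Qed.

HB.instance Definition _ := gen_eqMixin Omega.
HB.instance Definition _ := gen_choiceMixin Omega.

Definition Omega_emb (w : Omega) :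
  prod_topology (fun i : labelled => discrete_topology (target i)) :=
  fun i => w i.

HB.instance Definition _ :=
  Topological.copy Omega (initial_topology Omega_emb).

Lemma Omega_mul_compatible (v w : Omega) :
  compatible (fun i => (v i * w i)%g).
Proof.
by move=> i j h hl; rewrite gmulfM (Omega_coordP v hl)
  (Omega_coordP w hl).
Qed.

Definition Omega_mul v w := MkOmega (Omega_mul_compatible v w).

Lemma Omega_mulA : associative Omega_mul.
Proof. by move=> u v w; apply: Omega_eq => i /=; exact: mulgA. Qed.

HB.instance Definition _ := isSemigroup.Build Omega Omega_mulA.

Lemma Omega_mulE (v w : Omega) i : (v * w)%g i = (v i * w i)%g.
Proof. by []. Qed.

Lemma Omega_cvgP (F : set_system Omega) (w : Omega) : Filter F ->
  (F --> w) <-> (forall i, F [set v : Omega | v i = w i]).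
Proof.
move=> FF; split=> [Fw i|Fw].
  have H : nbhs (Omega_emb w) (proj i @^-1` [set w i]).
    have ce : nbhs (Omega_emb w) --> Omega_emb w by exact: cvg_id.
    apply: (((@cvg_sup _ _ _ _ _ (nbhs_filter (Omega_emb w))).1 ce) i).
    exists (proj i @^-1` [set w i]); split=> //.
    by exists [set w i] => //; exact: discrete_open.
  by have /Fw := @initial_continuous _ _ Omega_emb w _ H.
have Fe : Omega_emb @ F --> Omega_emb w.
  apply/cvg_sup => i W [B' [[D _ BD] B'w] B'W].
  apply: (@filterS _ _ _ B' _ B'W); rewrite -BD.
  apply: (@filterS _ F _ _ _ _ (Fw i)) => v /= vw.
  by rewrite /proj /Omega_emb vw; move: B'w; rewrite -BD.
move=> U [B [[C oC BC] Cw] BU].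
have nC : nbhs (Omega_emb w) C.
  by apply: open_nbhs_nbhs; split=> //; move: Cw; rewrite -BC.
by apply: (@filterS _ _ _ B _ BU); rewrite -BC; exact: (Fe C nC).
Qed.

Lemma Omega_nbhs (w : Omega) i : nbhs w [set v : Omega | v i = w i].
Proof. by move: i; apply/Omega_cvgP. Qed.

Lemma Omega_mul_continuous :
  continuous (fun xy : Omega * Omega => (xy.1 * xy.2)%g).
Proof.
move=> [x y]; apply/Omega_cvgP => i /=.
exists ([set v : Omega | v i = x i], [set v : Omega | v i = y i]) => /=.
  by split; exact: Omega_nbhs.
by move=> [x' y'] /= [-> ->].
Qed.

HB.instance Definition _ := isTopSemigroup.Build Omega Omega_mul_continuous.

Lemma gen_compatible (a : A) : compatible (fun i => label i a).
Proof. by move=> i j h; apply. Qed.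

Definition free_gen (a : A) : Omega := MkOmega (gen_compatible a).

Definition Omega_proj (i : labelled) (w : Omega) : target i := w i.

Lemma Omega_proj_mul i : {morph Omega_proj i : v w / (v * w)%g}.
Proof. by []. Qed.

HB.instance Definition _ i :=
  isMultiplicative.Build _ _ (Omega_proj i) (@Omega_proj_mul i).

Lemma Omega_proj_continuous i :
  continuous (Omega_proj i : Omega -> discrete_topology (target i)).
Proof.
move=> w U /= /nbhs_singleton Uw; apply: filterS (Omega_nbhs w i).
by move=> v /= vw; rewrite /Omega_proj vw.
Qed.

Lemma Omega_pro : pro V Omega.
Proof.
split.
- rewrite compact_ultra => F FU _.
  have FP : ProperFilter F by exact: ultra_proper.
  have H i : exists s, F [set v : Omega | v i = s].
    apply: contrapT => /forallNP nF.
    have : F [set v : Omega | forall s, v i <> s].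
      apply: filter_forall => s.
      by have [/nF|] := in_ultra_setVsetC [set v : Omega | v i = s] FU.
    by move=> /filter_ex [v /(_ (v i))].
  pose w i := projT1 (cid (H i)).
  have Fw i : F [set v : Omega | v i = w i] := projT2 (cid (H i)).
  have cw : compatible w.
    move=> i j h hl; have [v [/= <- <-]] := filter_ex (filterI (Fw i) (Fw j)).
    exact: Omega_coordP.
  by exists (MkOmega cw); split=> //; apply/Omega_cvgP.
- move=> p q pq; apply: Omega_eq => i.
  have [v [/= <- <-]] // := pq _ _ (Omega_nbhs p i) (Omega_nbhs q i).
- move=> x y xy; have [i xyi] : exists i, x i <> y i.
    by apply/existsNP => /Omega_eq.
  exists (target i), (Omega_proj i); split=> //.
    exact: targetV.
  exact: Omega_proj_continuous.
Qed.

End Omega.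

Section SubSemigroup.
Variables (S : finSemigroupType) (p : pred S).
Hypothesis pM : mulg_closed p.

Definition sub_semigroup : Type := let _ := pM in {x | p x}.

HB.instance Definition _ := SubFinite.copy sub_semigroup {x | p x}.
HB.instance Definition _ :=
  SubChoice_isSubSemigroup.Build S p sub_semigroup pM.

Definition sub_val (x : sub_semigroup) : S := val x.

Lemma sub_val_mul : {morph sub_val : x y / (x * y)%g}.
Proof. by []. Qed.

HB.instance Definition _ := isMultiplicative.Build _ _ sub_val sub_val_mul.

End SubSemigroup.

Section PairHom.
Variables (T : semigroupType) (S1 S2 : finSemigroupType).
Variables (f : {multiplicative T -> S1}) (g : {multiplicative T -> S2}).

Definition pair_hom (t : T) : (S1 * S2)%type := (f t, g t).

Lemma pair_hom_mul : {morph pair_hom : x y / (x * y)%g}.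
Proof. by move=> x y; rewrite /pair_hom !gmulfM. Qed.

HB.instance Definition _ := isMultiplicative.Build _ _ pair_hom pair_hom_mul.

End PairHom.

Lemma discrete_continuousP (T : topologicalType) (S : choiceType)
    (f : T -> discrete_topology S) :
  continuous f <-> forall t, nbhs t [set u | f u = f t].
Proof.
split=> [cf t|H t U /nbhs_singleton Uf].
  exact: (cf t [set f t] (discrete_set1 _)).
by apply: filterS (H t) => u /= ->.
Qed.

Section Free.
Variables (V : semigroup_class) (A : finType).
Hypotheses (pV : pseudovariety V) (a0 : A).

(* Each coordinate lies in the subsemigroup generated by the labels. *)
Lemma coord_generated (w : Omega V A) (i : labelled V A) (P : set (target i)) :
  (forall a, P (label i a)) -> (forall x y, P x -> P y -> P (x * y)%g) ->
  P (w i).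
Proof.
move=> Pl PM; pose p : pred (target i) := fun x => `[<P x>].
have pM : mulg_closed p.
  by move=> x y /asboolP Px /asboolP Py; apply/asboolP; exact: PM.
pose S : finSemigroupType := sub_semigroup pM.
have pl a : p (label i a) by apply/asboolP.
have VS : V S.
  apply: (pv_sub pV (f := @sub_val _ _ pM)); last exact: targetV.
    by apply/card_gt0P; exists (Sub (label i a0) (pl a0)).
  exact: val_inj.
pose l a : S := Sub (label i a) (pl a).
pose j := Label (pv_optable_of pV VS) (fun a => to_table (l a)).
pose h : {multiplicative target j -> target i} :=
  @sub_val _ _ pM \o @of_table S.
have <- : h (w j) = w i.
  by apply: Omega_coordP => a; rewrite /= to_tableK.
exact/asboolP/(valP (of_table (w j))).
Qed.

Section Extension.
Variables (T : topSemigroupType) (a : A -> T).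
Hypothesis pT : pro V T.

Record fin_image := FinImage {
  fi_S : optable;
  fi_f : {multiplicative T -> fi_S};
  fi_V : V fi_S;
  fi_c : continuous (fi_f : T -> discrete_topology fi_S) }.

Definition fi_label (q : fin_image) : labelled V A :=
  Label (fi_V q) (fun x => fi_f q (a x)).

Definition fi_set (w : Omega V A) (q : fin_image) : set T :=
  [set t | fi_f q t = w (fi_label q)].

Lemma fi_nbhs (q : fin_image) (t : T) : nbhs t [set u | fi_f q u = fi_f q t].
Proof. by move: t; apply/discrete_continuousP; exact: fi_c. Qed.

Lemma fi_set_neq0 w q : fi_set w q !=set0.
Proof.
apply: (@coord_generated w (fi_label q)
  [set s | [set t | fi_f q t = s] !=set0]) => [x|x y [t <-] [u <-]].
  by exists (a x).
by exists (t * u)%g; rewrite /= gmulfM.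
Qed.

Lemma fi_trivial : fin_image.
Proof.
pose S := trivial_table.
have cM : {morph (fun _ : T => ord0 : S) : x y / (x * y)%g} by [].
pose f : {multiplicative T -> S} := HB.pack (fun _ : T => ord0 : S)
  (isMultiplicative.Build _ _ _ cM).
have VS : V S by apply: (pv_trivial pV); rewrite card_ord.
exists S f => //; apply/discrete_continuousP => t.
by apply: filterS filterT.
Qed.

Lemma fi_pair (w : Omega V A) (q r : fin_image) :
  exists k, fi_set w k `<=` fi_set w q `&` fi_set w r.
Proof.
pose f : {multiplicative T -> _} := @to_table _ \o pair_hom (fi_f q) (fi_f r).
have cf : continuous
    (f : T -> discrete_topology (optable_of (fi_S q * fi_S r)%type)).
  apply/discrete_continuousP => t.
  apply: filterS (filterI (fi_nbhs q t) (fi_nbhs r t)) => u [/= uq ur].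
  by rewrite /pair_hom uq ur.
pose k := FinImage (pv_optable_of pV (pv_prod pV (fi_V q) (fi_V r))) cf.
have fi_sub (s : fin_image)
    (g : {multiplicative (fi_S q * fi_S r)%type -> fi_S s}) :
    (forall t, g (fi_f q t, fi_f r t) = fi_f s t) ->
  fi_set w k `<=` fi_set w s.
  move=> gf t /= kt.
  pose h : {multiplicative target (fi_label k) -> target (fi_label s)} :=
    g \o @of_table _.
  have hf u : h (fi_f k u) = fi_f s u by rewrite /= to_tableK gf.
  have hw : h (w (fi_label k)) = w (fi_label s).
    by apply: Omega_coordP => x; exact: hf.
  by rewrite /fi_set /= -hw -hf; congr (h _).
by exists k => t kt; split; [exact: (fi_sub q fst) kt|exact: (fi_sub r snd) kt].
Qed.

Lemma extension_ex w : exists t, forall q, fi_set w q t.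
Proof.
have [cT hT rT] := pT.
pose F := filter_from [set: fin_image] (fi_set w).
have FF : Filter F.
  by apply: filter_fromT_filter; [exists fi_trivial|exact: fi_pair].
have FP : ProperFilter F.
  by apply: filter_from_proper => q _; exact: fi_set_neq0.
have [t [_ Ft]] := cT F FP filterT.
exists t => q.
have [|u [/= uq tu]] := Ft (fi_set w q) _ _ (fi_nbhs q t); first by exists q.
by rewrite /fi_set /= -tu.
Qed.

Lemma extension_eq (t u : T) :
  (forall q : fin_image, fi_f q t = fi_f q u) -> t = u.
Proof.
move=> tu; apply: contrapT; have [_ _ rT] := pT; move=> /rT [S [f [VS cf]]].
apply; pose g : {multiplicative T -> _} := @to_table S \o f.
have cg : continuous (g : T -> discrete_topology (optable_of S)).
  apply/discrete_continuousP => x; move/discrete_continuousP: cf => /(_ x).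
  by apply: filterS => y /= ->.
exact: (can_inj (@to_tableK S)) (tu (FinImage (pv_optable_of pV VS) cg)).
Qed.

Definition extension (w : Omega V A) : T := projT1 (cid (extension_ex w)).

Lemma extensionP w q : fi_f q (extension w) = w (fi_label q).
Proof. exact: (projT2 (cid (extension_ex w)) q). Qed.

Lemma extension_mul : {morph extension : x y / (x * y)%g}.
Proof.
by move=> x y; apply: extension_eq => q; rewrite extensionP gmulfM !extensionP.
Qed.

Lemma extension_gen x : extension (free_gen V x) = a x.
Proof. by apply: extension_eq => q; rewrite extensionP. Qed.

Lemma extension_continuous : continuous extension.
Proof.
have [cT hT _] := pT => w.
have PF : ProperFilter (extension @ w).
  by apply: fmap_proper_filter; exact: nbhs_pfilter.
apply: (compact_cluster_set1 hT cT filterT PF filterT).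
have cl t : cluster (extension @ w) t -> t = extension w.
  move=> ct; apply: extension_eq => q.
  have [|u [/= eu <-]] := ct [set u | fi_f q u = fi_f q (extension w)] _ _
    (fi_nbhs q t); last by rewrite eu.
  apply: filterS (Omega_nbhs w (fi_label q)) => v /= vw.
  by rewrite !extensionP.
apply/seteqP; split=> [t /cl//|_ ->].
by have [t [_ ct]] := cT _ PF filterT; rewrite -(cl t ct).
Qed.

End Extension.

Lemma labelled_pair (w : Omega V A) (i j : labelled V A) :
  exists k : labelled V A,
    forall v : Omega V A, v k = w k -> v i = w i /\ v j = w j.
Proof.
pose k := Label (pv_optable_of pV (pv_prod pV (targetV i) (targetV j)))
  (fun x => to_table (label i x, label j x)).
exists k => v vk.
have kE (s : labelled V A)
    (g : {multiplicative (target i * target j)%type -> target s}) :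
    (forall x, g (label i x, label j x) = label s x) -> v s = w s.
  move=> gl; pose h : {multiplicative target k -> target s} := g \o @of_table _.
  have hl x : h (label k x) = label s x by rewrite /= to_tableK gl.
  by rewrite -(Omega_coordP v hl) -(Omega_coordP w hl) vk.
by split; [exact: (kE i fst)|exact: (kE j snd)].
Qed.

Lemma generators_dense (P : set (Omega V A)) :
  (forall x, P (free_gen V x)) -> (forall x y, P x -> P y -> P (x * y)%g) ->
  closure P = setT.
Proof.
move=> Pg PM; apply/seteqP; split=> // w _.
pose D i := [set v : Omega V A | P v /\ v i = w i].
pose F := filter_from [set: labelled V A] D.
have FF : Filter F.
  apply: filter_fromT_filter => [|i j].
    have VS : V trivial_table by apply: (pv_trivial pV); rewrite card_ord.
    by exists (Label VS (fun=> ord0 : trivial_table)).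
  have [k kP] := labelled_pair w i j.
  by exists k => v [Pv /kP[vi vj]]; split; split.
have Fw : F --> w by apply/Omega_cvgP => i; exists i => // v [].
move=> U /Fw [i _ DU].
have [v [Pv vi]] : [set s | exists v, P v /\ v i = s] (w i).
  apply: coord_generated => [x|_ _ [x [Px <-]] [y [Py <-]]].
    by exists (free_gen V x).
  by exists (x * y)%g; split; [exact: PM|].
by exists v; split=> //; exact: DU.
Qed.

Theorem Omega_free (T : topSemigroupType) (a : A -> T) : pro V T ->
  exists! f : Omega V A -> T,
    [/\ continuous f, {morph f : x y / (x * y)%g} &
        forall x, f (free_gen V x) = a x].
Proof.
move=> pT; exists (extension a pT); split.
  split; [exact: extension_continuous|exact: extension_mul|].
  exact: extension_gen.
move=> g [cg gM gg]; apply/funext => w; apply: (extension_eq pT) => q.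
have : closure [set v | extension a pT v = g v] w.
  rewrite generators_dense // => [x|x y /= xE yE].
    by rewrite /= extension_gen gg.
  by rewrite extension_mul gM xE yE.
have N1 : nbhs w [set v | fi_f q (extension a pT v) = fi_f q (extension a pT w)]
  := @extension_continuous T a pT w _ (fi_nbhs q _).
have N2 : nbhs w [set v | fi_f q (g v) = fi_f q (g w)] := cg w _ (fi_nbhs q _).
by move=> /(_ _ (filterI N1 N2)) [v [/= vE [/= <- <-]]]; rewrite vE.
Qed.

End Free.

Section Substitution.
Variables (V : semigroup_class) (B A : finType).

Lemma subst_compatible (v : B -> Omega V A) (w : Omega V B) :
  compatible (fun i : labelled V A => w (Label (targetV i) (fun b => v b i))).
Proof.
move=> i j h hl.
apply: (@Omega_coordP _ _ w (Label _ _) (Label _ _) h) => b /=.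
exact: Omega_coordP.
Qed.

(* The interpretation of [w] as a [B]-ary operation on [Omega V A], applied to
   [v]: the value at [w] of the continuous homomorphism extending [v]. *)
Definition subst (v : B -> Omega V A) (w : Omega V B) : Omega V A :=
  MkOmega (@subst_compatible v w).

Lemma subst_gen v b : subst v (free_gen V b) = v b.
Proof. exact: Omega_eq. Qed.

Lemma subst_mul v : {morph subst v : x y / (x * y)%g}.
Proof. by move=> x y; exact: Omega_eq. Qed.

Lemma subst_continuous v : continuous (subst v).
Proof.
move=> w; apply/(@Omega_cvgP _ _ _ _ (fmap_filter _ (nbhs_filter w))) => i.
exact: (Omega_nbhs w (Label (targetV i) (fun b => v b i))).
Qed.

End Substitution.

Definition pseudoword (A : finType) := Omega all_semigroups A.

Section Projection.
Variables (V : semigroup_class) (A : finType).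

Lemma proj_compatible (w : pseudoword A) :
  compatible (fun i : labelled V A =>
    w (@Label all_semigroups A (target i) I (@label _ _ i))).
Proof.
by move=> i j h hl; apply: (@Omega_coordP _ _ w (Label _ _) (Label _ _) h).
Qed.

Definition p_proj (w : pseudoword A) : Omega V A := MkOmega (proj_compatible w).

Lemma p_proj_gen a : p_proj (free_gen _ a) = free_gen V a.
Proof. exact: Omega_eq. Qed.

Lemma p_proj_mul : {morph p_proj : x y / (x * y)%g}.
Proof. by move=> x y; exact: Omega_eq. Qed.

Lemma p_proj_continuous : continuous p_proj.
Proof.
move=> w; apply/(@Omega_cvgP _ _ _ _ (fmap_filter _ (nbhs_filter w))) => i.
exact: (@Omega_nbhs all_semigroups A w (Label I (@label _ _ i))).
Qed.

End Projection.

Definition implicit_op := {k : nat & pseudoword 'I_k}.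

Definition mul_op : implicit_op :=
  existT _ 2 (free_gen _ (ord0 : 'I_2) * free_gen _ (lift ord0 ord0 : 'I_2))%g.

Definition implicit_signature (sigma : set implicit_op) : Prop := sigma mul_op.

Inductive sigma_generated (sigma : set implicit_op) (A : finType) :
    pseudoword A -> Prop :=
| sigma_gen a : sigma_generated sigma (free_gen _ a)
| sigma_op (k : nat) (w : pseudoword 'I_k) (v : 'I_k -> pseudoword A) :
    sigma (existT _ k w) -> (forall i, sigma_generated sigma (v i)) ->
    sigma_generated sigma (subst v w).

Section Power.
Context {S : semigroupType}.

(* [powS x n] is [x ^ (n + 1)]. *)
Definition powS (x : S) (n : nat) : S := iter n (mul x) x.

Lemma powS_mul x m n : (powS x m * powS x n)%g = powS x (m + n).+1.
Proof. by elim: m => //= m IH; rewrite -mulgA IH. Qed.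

Definition is_idempotent (x : S) : Prop := (x * x)%g = x.

Lemma idempotent_powS (e : S) n : is_idempotent e -> powS e n = e.
Proof. by move=> ee; elim: n => //= n ->. Qed.

Lemma powS_powS x m n : powS (powS x m) n = powS x (m.+1 * n.+1).-1.
Proof.
elim: n => [|n IH]; first by rewrite muln1.
rewrite [LHS]/= -/(powS (powS x m) n) IH powS_mul; congr powS.
by rewrite [in RHS]mulnS mulnS; lia.
Qed.

Lemma idempotent_power_unique x m n :
  is_idempotent (powS x m) -> is_idempotent (powS x n) -> powS x m = powS x n.
Proof.
move=> im i_n; rewrite -(idempotent_powS n im) -(idempotent_powS m i_n).
by rewrite !powS_powS mulnC.
Qed.

End Power.

Lemma gmulf_powS (S T : semigroupType) (f : {multiplicative S -> T}) x n :
  f (powS x n) = powS (f x) n.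
Proof. by elim: n => //= n IH; rewrite gmulfM IH. Qed.

(* The idempotent power of [x] is [x ^ (|S|!)]. *)
Definition omega_power (S : finSemigroupType) (x : S) : S :=
  powS x (#|S|)`!.-1.

Lemma omega_power_idempotent (S : finSemigroupType) (x : S) :
  is_idempotent (omega_power x).
Proof.
have [i [j [ij jS xij]]] :
    exists i j, [/\ i < j, j <= #|S| & powS x i = powS x j].
  have /injectivePn[i [j neq_ij eq_ij]] :
      ~~ injectiveb (fun i : 'I_#|S|.+1 => powS x i).
    by apply/negP => /injectiveP /leq_card; rewrite card_ord ltnn.
  have [lt_ij|lt_ji|] := ltngtP i j; last by
    move=> /val_inj e; rewrite e eqxx in neq_ij.
    by exists i, j; split=> //; rewrite -ltnS.
  by exists j, i; split=> //; rewrite -ltnS.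
have per m k : i <= m -> powS x (m + k * (j - i)) = powS x m.
  move=> im; elim: k => [|k IH]; first by rewrite addn0.
  rewrite -{}IH; case: (ltngtP i (m + k * (j - i))) => [lt_im||e].
  - have -> : m + k.+1 * (j - i) = (j + (m + k * (j - i) - i.+1)).+1 by nia.
    by rewrite -powS_mul -xij powS_mul; congr powS; lia.
  - by nia.
  - by rewrite -e xij; congr powS; nia.
have S0 : 0 < #|S| by apply/card_gt0P; exists x.
have fS : 0 < (#|S|)`! by exact: fact_gt0.
have leS : #|S| <= (#|S|)`!.
  by apply: dvdn_leq => //; apply: dvdn_fact; rewrite S0 leqnn.
have /dvdnP[k Ek] : j - i %| (#|S|)`!.
  by apply: dvdn_fact; apply/andP; lia.
rewrite /is_idempotent /omega_power powS_mul.
have -> : ((#|S|)`!.-1 + (#|S|)`!.-1).+1 = (#|S|)`!.-1 + k * (j - i) by lia.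
by apply: per; lia.
Qed.

Lemma omega_power_hom (S T : finSemigroupType) (f : {multiplicative S -> T}) x :
  f (omega_power x) = omega_power (f x).
Proof.
have i1 : is_idempotent (powS (f x) (#|S|)`!.-1).
  by rewrite -gmulf_powS /is_idempotent -gmulfM omega_power_idempotent.
rewrite gmulf_powS; apply: idempotent_power_unique i1 _.
exact: omega_power_idempotent.
Qed.

Lemma omega_compatible : compatible (fun i : labelled all_semigroups 'I_1 =>
  omega_power (label i ord0)).
Proof. by move=> i j h hl; rewrite omega_power_hom hl. Qed.

Definition omega_op : implicit_op := existT _ 1 (MkOmega omega_compatible).

Section Pointlike.
Variable V : semigroup_class.
Variables (S : finSemigroupType).

Definition onto_continuous (A : finType)
    (phi : {multiplicative pseudoword A -> S}) : Prop :=
  continuous (phi : pseudoword A -> discrete_topology S) /\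
  forall s, exists w, phi w = s.

Definition pointlike_witness (A : finType)
    (phi : {multiplicative pseudoword A -> S})
    (P : set S) (P' : set (pseudoword A)) : Prop :=
  phi @` P' = P /\ exists v, @p_proj V A @` P' = [set v].

Definition pointlike (P : set S) : Prop :=
  P !=set0 /\
  forall (A : finType) (phi : {multiplicative pseudoword A -> S}),
    onto_continuous phi -> exists P', pointlike_witness phi P P'.

End Pointlike.

Definition pointlike_reducible (V : semigroup_class) (sigma : set implicit_op) :
    Prop :=
  forall (S : finSemigroupType) (P : set S), pointlike V P ->
  forall (A : finType) (phi : {multiplicative pseudoword A -> S}),
    onto_continuous phi ->
    exists2 P', P' `<=` @sigma_generated sigma A & pointlike_witness V phi P P'.

(* Main.v *)
(** Write [V] for [DO_inter H]. In [DO] the regular J-classes are rectangular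
groups, equivalently [efe = e] for J-equivalent idempotents. Two consequences
drive the proof, by induction on the common content of the [u i].

- A pseudoword [w] has a unique factorization [w = x a y] in which the letter
  [a] is not in the content of [x] and [x a] has the content of [w], and the
  values of [x], [a], [y] in [V] depend only on the value of [w] in [V]:
  [x], [a], [y] can be read off the value of [w] in a finite semigroup that
  records the first point of full content, and which lies in [V] when it is
  built over a member of [V].
- If [y], [z] have full content, then the value of [y^omega m z^omega] in [V]
  depends only on the values of [y], [z] in [V] and of [m] in [H].

Factor each [u i] repeatedly from the left. If a remainder of smaller content
appears, induction applies. Otherwise two of the partial products have the same
value in [S] for all [i], so that the prefix can be replaced by [x y^omega].
The same is done from the right on the remainder, and [H]-reducibility is
applied to what is left in the middle. *)

From HB Require Import structures.
Require Import Defs.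
From mathcomp Require Import all_boot all_classical.
From mathcomp Require Import topology.

Set Implicit Arguments.
Unset Strict Implicit.
Unset Printing Implicit Defensive.

Local Open Scope classical_set_scope.

(** * Green's J-order and DO *)

Section AdjoinOne.
Local Open Scope group_scope.
Variable T : semigroupType.

(** [None] is an adjoined identity. The same encoding later serves for factors of a pseudoword that
    may be empty. *)
Definition omul (x y : option T) : option T :=
  match x, y with
  | Some s, Some t => Some (s * t)
  | None, _ => y
  | _, None => x
  end.

Lemma omulA : associative omul.
Proof. by case=> [x|] [y|] [z|] //=; rewrite mulgA. Qed.

HB.instance Definition _ := isSemigroup.Build (option T) omulA.

Lemma omul0x (x : option T) : None * x = x. Proof. by case: x. Qed.

Lemma omulx0 (x : option T) : x * None = x. Proof. by case: x. Qed.

Lemma omulSS (s t : T) : Some s * Some t = Some (s * t). Proof. by []. Qed.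

End AdjoinOne.

Lemma omap_mul (S T : semigroupType) (h : S -> T) :
  {morph h : x y / (x * y)%g} -> {morph omap h : x y / (x * y)%g}.
Proof. by move=> hM [x|] [y|] //=; rewrite omulSS /= hM. Qed.

Section JOrder.
Local Open Scope group_scope.
Variable T : semigroupType.
Implicit Types e f x y z : T.

Lemma J_leP x y :
  J_le x y <-> exists p q : option T, Some x = p * Some y * q.
Proof.
split=> [[->|[s ->]|[t ->]|[s [t ->]]]|[[p|] [[q|] []]]] //.
- by exists None, None.
- by exists (Some s), None.
- by exists None, (Some t).
- by exists (Some s), (Some t).
- by move=> ->; apply: Or44; exists p, q.
- by move=> ->; apply: Or42; exists p.
- by move=> ->; apply: Or43; exists q.
- by move=> ->; apply: Or41.
Qed.

Lemma J_le_refl x : J_le x x. Proof. exact: Or41. Qed.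

Lemma J_le_mul x y p q : x = p * y * q -> J_le x y.
Proof. by move=> ->; apply: Or44; exists p, q. Qed.

Lemma J_le_mull x y p : x = p * y -> J_le x y.
Proof. by move=> ->; apply: Or42; exists p. Qed.

Lemma J_le_mulr x y q : x = y * q -> J_le x y.
Proof. by move=> ->; apply: Or43; exists q. Qed.

Lemma J_le_trans x y z : J_le x y -> J_le y z -> J_le x z.
Proof.
move=> /J_leP[p [q xE]] /J_leP[r [s yE]]; apply/J_leP.
by exists (p * r), (s * q); rewrite xE yE !mulgA.
Qed.

(** Padding with [e] on both sides, as [e = e * e * e], turns multipliers that may be absent into
    elements of [T]. *)
Lemma J_le_idem e x : is_idempotent e -> J_le e x ->
  exists p q, e = p * x * q.
Proof.
move=> ee /J_leP[p [q eE]].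
have : Some e = (Some e * p) * Some x * (q * Some e).
  by rewrite -!mulgA [p * _]mulgA [p * Some x * _]mulgA -eE !omulSS ee ee.
case: p q {eE} => [p|] [q|] /=; rewrite ?omulx0 ?omul0x !omulSS => -[eE].
- by exists (e * p), (q * e).
- by exists (e * p), e.
- by exists e, (q * e).
- by exists e, e.
Qed.

(* For finite [T] this is membership in [DO], see [DO_orthodox]. *)
Definition J_orthodox : Prop := forall e f : T,
  is_idempotent e -> is_idempotent f -> J_le e f -> J_le f e -> e * f * e = e.

End JOrder.
Arguments J_orthodox : clear implicits.

Lemma J_le_hom (T T' : semigroupType) (h : {multiplicative T -> T'}) x y :
  J_le x y -> J_le (h x) (h y).
Proof.
case=> [->|[s ->]|[t ->]|[s [t ->]]]; rewrite ?gmulfM.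
- exact: J_le_refl.
- exact: J_le_mull.
- exact: J_le_mulr.
- exact: J_le_mul.
Qed.

Section Orthodox.
Local Open Scope group_scope.
Variable T : semigroupType.
Hypothesis oT : J_orthodox T.
Implicit Types e f g x y z : T.

Definition J_idem e f := [/\ is_idempotent f, J_le e f & J_le f e].

Lemma J_idem_refl e : is_idempotent e -> J_idem e e.
Proof. by split=> //; exact: J_le_refl. Qed.

Lemma J_idem_trans e f g : J_idem e f -> J_idem f g -> J_idem e g.
Proof.
case=> _ ef fe [gg fg gf].
by split=> //; [exact: J_le_trans fg|exact: J_le_trans fe].
Qed.

Lemma J_idem_sym e f : is_idempotent e -> J_idem e f -> J_idem f e.
Proof. by move=> ee [_ ef fe]. Qed.

Lemma J_idem3 e f : is_idempotent e -> J_idem e f -> e * f * e = e.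
Proof. by move=> ee [ff ef fe]; exact: oT. Qed.

(** [f * g * f = f] makes [f * g] idempotent and J-equivalent to [f]. *)
Lemma J_idem_mul e f g : is_idempotent e -> J_idem e f -> J_idem e g ->
  J_idem e (f * g).
Proof.
move=> ee ef eg; have [ff _ _] := ef.
have fg : J_idem f g by exact: J_idem_trans (J_idem_sym ee ef) eg.
apply: (J_idem_trans ef); split.
- by rewrite /is_idempotent mulgA (J_idem3 ff fg).
- by apply: (@J_le_mulr _ _ _ f); rewrite (J_idem3 ff fg).
- exact: (@J_le_mulr _ _ _ g).
Qed.

(** The law of rectangular bands: expand [h] to [h * f * h] and contract [f * (g * h) * f] to
    [f]. *)
Lemma J_idem_mid e f g h : is_idempotent e ->
  J_idem e f -> J_idem e g -> J_idem e h -> f * g * h = f * h.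
Proof.
move=> ee ef eg eh; have [ff _ _] := ef; have [hh _ _] := eh.
have fe := J_idem_sym ee ef; have he := J_idem_sym ee eh.
rewrite -{1}(J_idem3 hh (J_idem_trans he ef)) !mulgA.
have -> // : f * g * h * f = f.
by rewrite -(mulgA f g); apply: J_idem3 => //;
  apply: J_idem_mul => //; exact: J_idem_trans fe _.
Qed.

(** If [e = p * x * q], then [x * q * e * p] is an idempotent of the J-class of [e]. Orthodoxy for
    it and [e] reads [e * x * z = e] with [z = q * e * p * e]. *)
Lemma J_idem_right e x : is_idempotent e -> J_le e x ->
  exists z, e * x * z = e /\ z * e = z.
Proof.
move=> ee /(J_le_idem ee)[p [q eE]].
have E w : w * p * x * q = w * e by rewrite eE !mulgA.
have E2 w : w * e * e = w * e by rewrite -mulgA ee.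
have fJ : J_idem e (x * q * e * p).
  split.
  - by rewrite /is_idempotent !mulgA !E !E2.
  - apply: (@J_le_mul _ _ _ p (x * q)).
    by rewrite !mulgA -eE ee E ee.
  - exact: (@J_le_mul _ _ _ (x * q) p).
exists (q * e * p * e); split; last by rewrite E2.
by have := J_idem3 ee fJ; rewrite !mulgA.
Qed.

Lemma J_idem_left e x : is_idempotent e -> J_le e x ->
  exists z, z * x * e = e /\ e * z = z.
Proof.
move=> ee /(J_le_idem ee)[p [q eE]].
have E w : w * p * x * q = w * e by rewrite eE !mulgA.
have E2 w : w * e * e = w * e by rewrite -mulgA ee.
have fJ : J_idem e (q * e * p * x).
  split.
  - by rewrite /is_idempotent !mulgA !E !E2.
  - apply: (@J_le_mul _ _ _ (p * x) q).
    by rewrite !mulgA -eE ee E ee.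
  - by apply: (@J_le_mul _ _ _ q (p * x)); rewrite !mulgA.
exists (e * q * e * p); split; last by rewrite !mulgA ee.
by have := J_idem3 ee fJ; rewrite !mulgA.
Qed.

End Orthodox.

(** * The local monoid at an idempotent *)

Section LocalGroup.
Local Open Scope group_scope.
Variable T : semigroupType.
Hypothesis oT : J_orthodox T.
Implicit Types e f g x y z : T.

(** Take [h = z * e * x], where [e * x * z = e]. *)
Lemma J_right_unit e x : is_idempotent e -> J_le e x ->
  exists2 h, J_idem e h & e * x * h = e * x.
Proof.
move=> ee ex; have [z [exz ze]] := J_idem_right oT ee ex.
have E w : w * e * x * z = w * e by rewrite -2!mulgA (mulgA e) exz.
have E2 w : w * e * e = w * e by rewrite -mulgA ee.
exists (z * e * x); last by rewrite !mulgA exz ee.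
split.
- by rewrite /is_idempotent !mulgA !E !E2.
- apply: (@J_le_mul _ _ _ (e * x) z).
  by rewrite !mulgA exz ee exz.
- exact: J_le_mul.
Qed.

Lemma J_left_unit e x : is_idempotent e -> J_le e x ->
  exists2 h, J_idem e h & h * (x * e) = x * e.
Proof.
move=> ee ex; have [z [zxe ez]] := J_idem_left oT ee ex.
have E w : w * z * x * e = w * e by rewrite -2!mulgA (mulgA z) zxe.
have E2 w : w * e * e = w * e by rewrite -mulgA ee.
exists (x * e * z); last by rewrite !mulgA !E ?E2.
split.
- by rewrite /is_idempotent !mulgA !E ?E2.
- apply: (@J_le_mul _ _ _ z (x * e)).
  by rewrite !mulgA zxe ez zxe.
- exact: J_le_mul.
Qed.

(** [e * x] ends in an idempotent [h] of the J-class, so multiplication by [y] can be undone on the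
    right as it can after [h]; then [x] is undone too, which leads back to [e]. *)
Lemma J_le_idem_mul e x y :
  is_idempotent e -> J_le e x -> J_le e y -> J_le e (x * y).
Proof.
move=> ee ex ey; have [h [hh eh he] exh] := J_right_unit ee ex.
have [z [exz ze]] := J_idem_right oT ee ex.
have [z' [hyz _]] := J_idem_right oT hh (J_le_trans he ey).
apply: (@J_le_mul _ _ _ e (z' * z)).
by rewrite -{1}exz -exh -{1}hyz !mulgA exh.
Qed.

(** [e * x] ends and [y * e] begins with an idempotent of the J-class, and [J_idem_mid] inserts [e]
    between the two. *)
Lemma J_idem_bimul e x y : is_idempotent e -> J_le e x -> J_le e y ->
  e * (x * y) * e = (e * x * e) * (e * y * e).
Proof.
move=> ee ex ey; have [h eh exh] := J_right_unit ee ex.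
have [h' eh' hye] := J_left_unit ee ey.
have -> : e * (x * y) * e = e * x * h * (h' * (y * e)).
  by rewrite exh hye !mulgA.
have -> : e * x * e * (e * y * e) = e * x * (h * e * h') * (y * e).
  have E w : w * h' * y * e = w * y * e by rewrite -!mulgA hye.
  by rewrite !mulgA exh E -[e * x * e * e]mulgA ee.
by rewrite (J_idem_mid oT ee eh (J_idem_refl ee) eh') !mulgA.
Qed.

Lemma J_idem_absorb e f x : is_idempotent e -> J_idem e f -> J_le e x ->
  e * x * f = e * x * e * f.
Proof.
move=> ee ef ex; have [h eh exh] := J_right_unit ee ex.
rewrite -exh -!mulgA; congr (_ * (_ * _)).
by rewrite !mulgA (J_idem_mid oT ee eh (J_idem_refl ee) ef).
Qed.

(** The two one-sided inverses coincide, as in any monoid; here [e] is the identity. *)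
Lemma J_local_inv e x : is_idempotent e -> J_le e x ->
  exists y, e * x * e * (e * y * e) = e /\ e * y * e * (e * x * e) = e.
Proof.
move=> ee ex; have [z [exz ze]] := J_idem_right oT ee ex.
have [z' [zxe ez']] := J_idem_left oT ee ex.
have R : e * x * e * (e * z * e) = e.
  rewrite -J_idem_bimul //; first by rewrite mulgA exz ee.
  by apply: (@J_le_mull _ _ _ (e * x)); rewrite exz.
have L : e * z' * e * (e * x * e) = e.
  rewrite -J_idem_bimul //; first by rewrite mulgA ez' zxe.
  by apply: (@J_le_mulr _ _ _ (x * e)); rewrite mulgA zxe.
exists z; split=> //.
have -> // : e * z * e = e * z' * e.
transitivity (e * z' * e * (e * x * e) * (e * z * e)).
  by rewrite L !mulgA ee.
by rewrite -[LHS]mulgA R -mulgA ee.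
Qed.

End LocalGroup.

Section LocalSubgroup.
Local Open Scope group_scope.
Variables (T : finSemigroupType) (e : T).

(** The units of the monoid [e * T * e], that is, the maximal subgroup at [e]. The witness [y]
    ranges over [T]; then [e * y * e] is the inverse inside the monoid. *)
Definition in_local_group (x : T) : bool :=
  `[< exists y, [/\ e * x = x, x * e = x, x * y = e & y * x = e] >].

Lemma in_local_group_mul : mulg_closed in_local_group.
Proof.
move=> x y /asboolP[x' [ex xe xx x'x]] /asboolP[y' [ey ye yy y'y]].
apply/asboolP; exists (y' * x'); split.
- by rewrite mulgA ex.
- by rewrite -mulgA ye.
- by rewrite !mulgA -(mulgA x) yy xe xx.
- by rewrite !mulgA -(mulgA y') x'x -mulgA ey y'y.
Qed.

Definition local_group : finSemigroupType := sub_semigroup in_local_group_mul.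

Definition local_val : {multiplicative local_group -> T} :=
  @sub_val _ _ in_local_group_mul.

Lemma local_val_inj : injective local_val.
Proof. exact: val_inj. Qed.

Lemma local_groupP (x : local_group) : e * local_val x = local_val x /\
  local_val x * e = local_val x.
Proof. by have /asboolP[y []] := valP x. Qed.

Lemma local_groupV (x : local_group) :
  exists y, local_val x * y = e /\ y * local_val x = e.
Proof. by have /asboolP[y []] := valP x; exists y. Qed.

Lemma local_group_sub x : in_local_group x -> exists y, local_val y = x.
Proof. by move=> Gx; exists (Sub x Gx); exact: SubK. Qed.

Lemma in_local_group1 : is_idempotent e -> in_local_group e.
Proof. by move=> ee; apply/asboolP; exists e. Qed.

Lemma is_group_local : is_idempotent e -> is_group local_group.
Proof.
move=> ee; have [e' e'E] := local_group_sub (in_local_group1 ee).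
exists e' => [x|x].
  have [ex xe] := local_groupP x.
  by split; apply: local_val_inj; rewrite gmulfM e'E.
have /asboolP[y [ex xe xy yx]] := valP x.
have [|y' y'E] := @local_group_sub (e * y * e).
  apply/asboolP; exists (local_val x).
  split.
  - by rewrite !mulgA ee.
  - by rewrite -mulgA ee.
  - by rewrite -mulgA ex -(mulgA e) yx ee.
  - by rewrite !mulgA xe xy ee.
exists y'; split; apply: local_val_inj; rewrite gmulfM e'E y'E.
- by rewrite -mulgA ex -(mulgA e) yx ee.
- by rewrite !mulgA xe xy ee.
Qed.

End LocalSubgroup.
Arguments local_val {T e}.

Lemma in_local_groupP (T : finSemigroupType) (e x : T) : J_orthodox T ->
  is_idempotent e -> J_le e x -> in_local_group e (e * x * e)%g.
Proof.
move=> oT ee ex; have [y [xy yx]] := J_local_inv oT ee ex.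
apply/asboolP; exists (e * y * e)%g; split=> //; first by rewrite !mulgA ee.
by rewrite -mulgA ee.
Qed.

(** * Product decomposition of regular J-classes *)

Section DO.
Local Open Scope group_scope.
Variable S : finSemigroupType.

(** In a product of a band and a group, an idempotent has trivial group coordinate, so only the
    rectangular law for the band coordinates remains. *)
Lemma DO_J_orthodox : DO S -> J_orthodox S.
Proof.
move=> dS e f ee ff ef fe.
have [|B [G [h [bB [e0 e01 invG] hi hJ]]]] := dS (J_class e).
  by exists e => //; exists e; rewrite ee.
have : range h e by rewrite hJ; split; exact: J_le_refl.
have : range h f by rewrite hJ.
have id1 b g : is_idempotent (h (b, g)) -> g = e0.
  rewrite /is_idempotent -gmulfM => /hi [_ gg].
  have [y [yg _]] := invG g.
  by rewrite -(e01 g).1 -yg -mulgA gg.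
move=> [[b g] _ E1] [[c k] _ E2].
rewrite -{}E1 in ff *; rewrite -{}E2 in ee *.
rewrite (id1 _ _ ff) (id1 _ _ ee) -!gmulfM; congr (h (_, _)) => /=.
  exact: (bB _ _).2.
by rewrite !(e01 e0).1.
Qed.

Section Rees.
Hypothesis oS : J_orthodox S.
Variable e : S.
Hypothesis ee : is_idempotent e.

Definition in_band (x : S) : bool := `[< J_idem e x >].

Lemma in_band_mul : mulg_closed in_band.
Proof.
by move=> x y /asboolP ex /asboolP ey; apply/asboolP; exact: J_idem_mul.
Qed.

Definition band : finSemigroupType := sub_semigroup in_band_mul.
Definition band_val : {multiplicative band -> S} :=
  @sub_val _ _ in_band_mul.

Lemma band_val_inj : injective band_val.
Proof. exact: val_inj. Qed.

Lemma bandP (b : band) : J_idem e (band_val b).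
Proof. exact/asboolP/(valP b). Qed.

Lemma rectangular_band_band : rectangular_band band.
Proof.
move=> x y; split; apply: (val_inj (sT := band)).
- by case: (bandP x).
- have [xx ex xe] := bandP x.
  by apply: (J_idem3 oS xx); exact: J_idem_trans (J_idem_sym ee _) (bandP y).
Qed.

(** Transports an element of the maximal subgroup at [e] to the maximal subgroup at the idempotent
    [b]. *)
Definition rees_map (x : (band * local_group e)%type) : S :=
  band_val x.1 * local_val x.2 * band_val x.1.

Lemma rees_mapE b g :
  rees_map (b, g) = band_val b * local_val g * band_val b.
Proof. by []. Qed.

Lemma rees_map_mul : {morph rees_map : x y / x * y}.
Proof.
move=> [b0 g0] [c0 h0]; rewrite -[_ * _]/(b0 * c0, g0 * h0) !rees_mapE.
rewrite !gmulfM.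
have [] := (local_groupP g0, local_groupP h0).
move: (local_val g0) (local_val h0) => g h [eg ge] [eh he].
move: (band_val b0) (band_val c0) (bandP b0) (bandP c0) => b c eb ec.
(* Both sides reduce to this product: on the left, [e] is inserted next to [b * c] and one band
   factor disappears; on the right, [e * (b * c) * e = e]. *)
have ej := J_idem_refl ee; transitivity (b * g * h * c).
  transitivity (b * c * e * g * h * (e * b * c)); last first.
    rewrite (J_idem_mid oS ee eb ec ej) (J_idem_mid oS ee ej eb ec).
    by rewrite mulgA -(mulgA b) eg -(mulgA _ h) he.
  by rewrite !mulgA -(mulgA _ e g) eg -(mulgA _ h e) he.
transitivity (b * g * (e * (b * c) * e) * h * c).
  by rewrite (J_idem3 oS ee (J_idem_mul oS ee eb ec)) -(mulgA b g e) ge.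
by rewrite !mulgA -(mulgA b g) ge -(mulgA _ e h) eh.
Qed.

HB.instance Definition _ := isMultiplicative.Build _ _ rees_map rees_map_mul.

Definition rees_hom : {multiplicative (band * local_group e)%type -> S} :=
  rees_map.

(** Multiplying by [e] on both sides recovers [g]. Cancelling [g] then recovers [b * e] and [e * b],
    which determine [b = b * e * b]. *)
Lemma rees_map_inj : injective rees_map.
Proof.
move=> [b g] [c h]; rewrite !rees_mapE => bc.
have K (b' : band) (g' : local_group e) :
  e * (band_val b' * local_val g' * band_val b') * e = local_val g'.
  have [eg ge] := local_groupP g'.
  have B3 := J_idem3 oS ee (bandP b').
  transitivity
    (e * band_val b' * e * local_val g' * (e * band_val b' * e)).
    rewrite !mulgA -(mulgA _ e (local_val g')) eg.
    by rewrite -(mulgA _ (local_val g') e) ge.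
  by rewrite B3 eg ge.
have gh : g = h by apply: local_val_inj; rewrite -(K b g) -(K c h) bc.
subst h; congr pair; apply: band_val_inj.
have [k [gk kg]] := local_groupV g; have [eg ge] := local_groupP g.
move: (band_val b) (band_val c) (local_val g) eg ge gk kg bc (bandP b)
  (bandP c) => {K}{}b {}c {}g eg ge gk kg bc eb ec.
have R b' : J_idem e b' -> b' * g * b' * e * k = b' * e.
  move=> eb'; transitivity (b' * g * (e * b' * e) * k).
    by rewrite !mulgA -(mulgA b' g e) ge.
  by rewrite (J_idem3 oS ee eb') -(mulgA b' g e) ge -mulgA gk.
have L b' : J_idem e b' -> k * (e * b' * g * b') = e * b'.
  move=> eb'; transitivity (k * (e * b' * e) * (g * b')).
    by rewrite !mulgA -(mulgA _ e g) eg.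
  by rewrite (J_idem3 oS ee eb') mulgA -(mulgA k e g) eg kg.
have be : b * e = c * e by rewrite -(R b) // -(R c) // bc.
have eb1 : e * b = e * c.
  by rewrite -(L b) // -(L c) // -!mulgA (mulgA b) bc -mulgA.
have [[bb _ _] [cc _ _]] := (eb, ec).
rewrite -(J_idem3 oS bb (J_idem_sym ee eb)) -(J_idem3 oS cc (J_idem_sym ee ec)).
by rewrite be -mulgA eb1 mulgA.
Qed.

(** Factor [x = P * Q] through [e]. With [z * P = e] and [Q * z' = e], the product [z' * z] is a
    weak inverse. *)
Lemma J_class_regular x : J_le e x -> J_le x e -> exists y, x = x * y * x.
Proof.
move=> ex /J_leP[p [q xE]].
have [P [Q [xPQ Pe eQ]]] : exists P Q, [/\ x = P * Q, P * e = P & e * Q = Q].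
  case: p q xE => [p|] [q|]; rewrite ?omul0x ?omulx0 ?omulSS => -[->].
  - by exists (p * e), (e * q); rewrite !mulgA -!(mulgA _ e e) ee.
  - by exists (p * e), e; rewrite -!mulgA ee.
  - by exists e, (e * q); rewrite !mulgA ee.
  - by exists e, e.
have [z [zP _]] := J_idem_left oS ee (J_le_trans ex (J_le_mulr xPQ)).
have [z' [Qz _]] := J_idem_right oS ee (J_le_trans ex (J_le_mull xPQ)).
exists (z' * z); rewrite eQ in Qz; rewrite -mulgA Pe in zP.
by rewrite xPQ -!mulgA (mulgA z P) zP eQ (mulgA Q) Qz (mulgA P) Pe.
Qed.

Lemma rees_map_range : range rees_map = J_class e.
Proof.
apply/seteqP; split=> [_ [[b g] _ <-]|x [ex xe]].
  rewrite rees_mapE.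
  have [k [gk _]] := local_groupV g; have [eg ge] := local_groupP g.
  have := J_idem3 oS ee (bandP b).
  move: (band_val b) (local_val g) eg ge gk => {}b {}g eg ge gk bE.
  split; last first.
    by apply: (@J_le_mul _ _ _ (b * g) b); rewrite -(mulgA b g e) ge.
  apply: (@J_le_mul _ _ _ e (e * k)).
  transitivity (e * b * e * g * (e * b * e) * k); first by rewrite bE eg ge gk.
  by rewrite !mulgA -(mulgA _ e g) eg -(mulgA _ g e) ge.
have [y xE] := J_class_regular ex xe.
have xyJ : J_idem e (x * y).
  split.
  - by rewrite /is_idempotent mulgA -xE.
  - exact/(J_le_trans ex)/(J_le_mulr xE).
  - by apply: J_le_trans xe; exact: J_le_mulr.
have yxJ : J_idem e (y * x).
  split.
  - by rewrite /is_idempotent -mulgA (mulgA x) -xE.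
  - by apply/(J_le_trans ex)/(@J_le_mull _ _ _ x); rewrite mulgA.
  - by apply: J_le_trans xe; exact: J_le_mull.
(* This idempotent is R-equivalent to [x * y] and L-equivalent to [y * x], so it is the one in the
   H-class of [x]; the group coordinate is [e * x * e]. *)
have [b bE] : exists b, band_val b = x * y * (y * x).
  have Bb : in_band (x * y * (y * x)) by apply/asboolP/J_idem_mul.
  by exists (Sub _ Bb); exact: SubK.
have [g gE] := local_group_sub (in_local_groupP oS ee ex).
exists (b, g) => //; rewrite rees_mapE bE gE.
have e1 := J_idem_refl ee; have [xyi _ _] := xyJ; have [yxi _ _] := yxJ.
have L : x * y * (y * x) * e * (x * y) = x * y.
  rewrite (J_idem_mid oS ee xyJ yxJ e1).
  by rewrite (J_idem_mid oS ee xyJ e1 xyJ).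
have R : y * x * (e * (x * y * (y * x))) = y * x.
  rewrite mulgA (J_idem_mid oS ee yxJ e1); last exact: J_idem_mul.
  by rewrite mulgA (J_idem_mid oS ee yxJ xyJ yxJ).
transitivity
  (x * y * (y * x) * e * (x * y) * x * (y * x * (e * (x * y * (y * x))))).
  rewrite -[in RHS](mulgA _ (x * y) x) -xE -(mulgA _ x (y * x * _)).
  by rewrite (mulgA x (y * x)) (mulgA x y x) -xE !mulgA.
by rewrite L R -xE mulgA -xE.
Qed.

End Rees.

Lemma DO_orthodox : DO S <-> J_orthodox S.
Proof.
split=> [|oS J [x [y xyx] ->]]; first exact: DO_J_orthodox.
have ee : is_idempotent (x * y) by rewrite /is_idempotent mulgA xyx.
have JE : J_class x = J_class (x * y).
  have xe : J_le x (x * y) by apply: (@J_le_mulr _ _ _ x); rewrite xyx.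
  have ex : J_le (x * y) x by exact: J_le_mulr.
  by apply/seteqP; split=> z [xz zx]; split; apply: J_le_trans; eassumption.
exists (band oS ee), (local_group (x * y)), (rees_hom oS ee); split.
- exact: rectangular_band_band.
- exact: is_group_local.
- exact: rees_map_inj.
- by rewrite JE; exact: rees_map_range.
Qed.

End DO.

(** * Closure properties of DO and of its intersection with the groups condition *)

Section Opposite.
Local Open Scope group_scope.
Variable t : optable.

Lemma opp_mulA : associative (fun x y : 'I_(table_size t) => opmul y x).
Proof. by move=> x y z /=; rewrite opmulA. Qed.

Definition opp_table : optable := OpTable opp_mulA.

Lemma opp_mulE (x y : t) :
  (x : opp_table) * (y : opp_table) = (y * x : t).
Proof. by []. Qed.

Lemma opp_J_le (x y : t) : J_le (x : opp_table) (y : opp_table) -> J_le x y.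
Proof.
case=> [->|[s ->]|[s ->]|[s [s' ->]]]; rewrite ?opp_mulE.
- exact: J_le_refl.
- exact: J_le_mulr.
- exact: J_le_mull.
- by apply: (@J_le_mul t _ _ s' s); rewrite mulgA.
Qed.

Lemma opp_J_orthodox : J_orthodox t -> J_orthodox opp_table.
Proof.
move=> ot e f ee ff /opp_J_le ef /opp_J_le fe.
by rewrite !opp_mulE mulgA; exact: ot.
Qed.

End Opposite.

Lemma opp_hom (t t' : optable) (h : {multiplicative t -> t'}) :
  {morph (h : opp_table t -> opp_table t') : x y / (x * y)%g}.
Proof. by move=> x y; rewrite !opp_mulE gmulfM. Qed.

Definition opp_mor (t t' : optable) (h : {multiplicative t -> t'}) :
    {multiplicative opp_table t -> opp_table t'} :=
  HB.pack (h : opp_table t -> opp_table t')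
    (isMultiplicative.Build (opp_table t) (opp_table t') h (opp_hom h)).

(** Composing with inversion turns a group embedded in the opposite of a semigroup into one embedded
    in the semigroup itself. *)
Lemma is_group_inv (G : semigroupType) : is_group G ->
  exists inv : G -> G, injective inv /\
    {morph inv : x y / (x * y)%g >-> (y * x)%g}.
Proof.
move=> [e e1 /choice[inv invP]]; exists inv.
have U x y : (x * y)%g = e -> y = inv x.
  by move=> xy; rewrite -(e1 y).1 -(invP x).1 -mulgA xy (e1 _).2.
have invK x : inv (inv x) = x by rewrite -(U (inv x) x) // (invP x).1.
split; first exact: can_inj invK.
move=> x y; apply/esym/U.
by rewrite -mulgA (mulgA y) (invP y).2 (e1 _).1 (invP x).2.
Qed.

Section ToTrivial.
Variable T : semigroupType.

Lemma to_trivial_mul :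
  {morph (fun _ : T => ord0 : trivial_table) : x y / (x * y)%g}.
Proof. by []. Qed.

Definition to_trivial : {multiplicative T -> trivial_table} := HB.pack
  (fun _ : T => ord0 : trivial_table)
  (isMultiplicative.Build _ _ _ to_trivial_mul).

End ToTrivial.

Section DOInter.
Local Open Scope group_scope.
Variable H : semigroup_class.

(* [c] plays the role of the content of [x]. *)
Lemma DO_inter_cover (U W : finSemigroupType) (pi : {multiplicative U -> W})
    (Z : finType) (c : U -> {set Z}) :
  {morph c : x y / x * y >-> x :|: y} ->
  (forall e x y, is_idempotent e -> c x \subset c e -> c y \subset c e ->
     e * x = x -> e * y = y -> pi x = pi y -> x = y) ->
  DO_inter H W -> DO_inter H U.
Proof.
move=> cM pi_eq [/DO_orthodox oW gW]; split.
  apply/DO_orthodox => e f ee ff ef fe.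
  have cJ x y : J_le x y -> c y \subset c x.
    move=> [->|[s ->]|[s ->]|[s [s' ->]]] //; rewrite !cM.
    - exact: finset.subsetUr.
    - exact: finset.subsetUl.
    - exact: fintype.subset_trans (finset.subsetUr _ _) (finset.subsetUl _ _).
  have piI x : is_idempotent x -> is_idempotent (pi x).
    by rewrite /is_idempotent -gmulfM => ->.
  apply: (pi_eq e) => //.
  - by rewrite !cM !finset.subUset subxx (cJ e f).
  - by rewrite !mulgA ee.
  - by rewrite !gmulfM; apply: oW; by [exact: piI|exact: J_le_hom].
move=> G f gG fi; apply: (gW G (pi \o f)) => // x y /= pxy; apply: fi.
have [e e1 inv] := gG.
have ce z : c (f z) \subset c (f e).
  by have [z' [<- _]] := inv z; rewrite gmulfM cM finset.subsetUr.
(* Inverses keep the content of [f z] within that of [f e], so [pi] is injective on the group and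
   embeds it in [W]. *)
apply: (pi_eq (f e)) => //; rewrite /is_idempotent -?gmulfM ?(e1 _).1 //.
Qed.

Lemma DO_inter_opp (t : optable) : DO_inter H t -> DO_inter H (opp_table t).
Proof.
move=> [/DO_orthodox ot gt]; split; first exact/DO_orthodox/opp_J_orthodox.
move=> G f gG fi; have [inv [inv_inj invM]] := is_group_inv gG.
have gM : {morph (fun x => f (inv x) : t) : x y / x * y}.
  by move=> x y; rewrite invM gmulfM opp_mulE.
pose g : {multiplicative G -> t} := HB.pack (fun x => f (inv x) : t)
  (isMultiplicative.Build _ _ _ gM).
by apply: (gt G g) => // x y /fi /inv_inj.
Qed.

Hypothesis pvH : pseudovariety_of_groups H.

Lemma DO_inter_group (G : finSemigroupType) : H G -> DO_inter H G.
Proof.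
move=> HG; have [e e1 inv] := pvH.2 _ HG; split.
  apply/DO_orthodox => f g ff gg _ _.
  have id1 h : is_idempotent h -> h = e.
    by move=> hh; have [k [kh _]] := inv h; rewrite -(e1 h).1 -kh -mulgA hh.
  by rewrite (id1 f) // (id1 g) // !(e1 _).1.
move=> K f [k _ _] fi; apply: (pv_sub pvH.1 _ fi HG).
by apply/card_gt0P; exists k.
Qed.

Lemma DO_inter_trivial : DO_inter H trivial_table.
Proof.
by apply: DO_inter_group; apply: (pv_trivial pvH.1); rewrite card_ord.
Qed.

Lemma DO_inter_optable_of (S : finSemigroupType) :
  DO_inter H S -> DO_inter H (optable_of S).
Proof.
apply: (@DO_inter_cover _ _ (@of_table S) void (fun=> finset.set0)).
  by move=> x y; rewrite finset.setU0.
by move=> e x y _ _ _ _ _; apply: can_inj (@of_tableK S) _ _.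
Qed.

End DOInter.

Section SetSemigroup.
Variable A : finType.

Definition set_semigroup : Type := {set A}.

HB.instance Definition _ := Finite.copy set_semigroup {set A}.
HB.instance Definition _ :=
  isSemigroup.Build set_semigroup (@finset.setUA A : associative _).

(** Makes content an invariant of the value in [DO_inter H]. Inside the content of [e], the equation
    [e * x = x] forces [x = e], so a cover of the trivial semigroup suffices. *)
Lemma DO_inter_set (H : semigroup_class) :
  pseudovariety_of_groups H -> DO_inter H set_semigroup.
Proof.
move=> pvH; have := DO_inter_trivial pvH.
apply: (@DO_inter_cover H set_semigroup _ (to_trivial _) A id) => // e x y _.
move=> /finset.setUidPl xe /finset.setUidPl ye ex ey _.
exact: etrans (etrans (esym ex) xe) (etrans (esym ye) ey).
Qed.

End SetSemigroup.

(** * Values and content of pseudowords *)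

Section Evaluation.
Local Open Scope group_scope.
Variable A : finType.
Implicit Types (T : finSemigroupType) (v w : pseudoword A).

(** Coordinates of a pseudoword are indexed by tables; passing through [optable_of] gives values in
    all finite semigroups. *)
Definition ev T (l : A -> T) w : T :=
  of_table (w (@Label all_semigroups A (optable_of T) I (@to_table _ \o l))).

Lemma ev_hom T T' (h : {multiplicative T -> T'}) (l : A -> T) w :
  h (ev l w) = ev (h \o l) w.
Proof.
rewrite /ev; set i := Label _ _; set j := Label _ _.
pose g : {multiplicative target i -> target j} :=
  @to_table T' \o (h \o @of_table T).
rewrite -(@Omega_coordP _ _ w i j g) /= ?to_tableK // => a.
by rewrite /= !to_tableK.
Qed.

Lemma ev_table (t : optable) (l : A -> t) w :
  ev l w = w (@Label all_semigroups A t I l).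
Proof.
rewrite /ev; set i := Label _ _; set j := Label _ _.
pose g : {multiplicative target i -> target j} := @of_table t.
by rewrite -(@Omega_coordP _ _ w i j g) // => a; rewrite /= to_tableK.
Qed.

Lemma ev_mul T (l : A -> T) : {morph ev l : x y / x * y}.
Proof. by move=> x y; rewrite /ev Omega_mulE of_table_mul. Qed.

HB.instance Definition _ T (l : A -> T) :=
  isMultiplicative.Build _ _ (ev l) (ev_mul l).

Lemma ev_gen T (l : A -> T) a : ev l (free_gen _ a) = l a.
Proof. exact: to_tableK. Qed.

Lemma ev_ext v w :
  (forall (t : optable) (l : A -> t), ev l v = ev l w) -> v = w.
Proof.
move=> vw; apply: Omega_eq => -[t [] l].
by rewrite -!ev_table vw.
Qed.

End Evaluation.

Lemma ev_subst (A B : finType) (T : finSemigroupType) (l : A -> T)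
    (v : B -> pseudoword A) (w : pseudoword B) :
  ev l (subst v w) = ev (fun b => ev l (v b)) w.
Proof.
rewrite {1}/ev /= -ev_table [LHS]ev_hom; congr (ev _ w).
Qed.

Lemma p_proj_eq (V : semigroup_class) (A : finType) (v w : pseudoword A) :
  p_proj V v = p_proj V w <->
  forall (t : optable) (l : A -> t), V t -> ev l v = ev l w.
Proof.
split=> [vw t l Vt|vw].
  by rewrite !ev_table; move/(congr1 (fun x : Omega V A => x (Label Vt l))): vw.
by apply: Omega_eq => -[t Vt l]; rewrite /= -!ev_table vw.
Qed.

Section EvaluationInduction.
Local Open Scope group_scope.
Variable A : finType.
Implicit Types (T : finSemigroupType) (w : pseudoword A).

Lemma empty_mulA : associative (fun x y : 'I_0 => x).
Proof. by []. Qed.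

(** Without letters the empty semigroup would be a target, and [w] would have a coordinate in it. *)
Lemma pseudoword_letter w : exists a : A, true.
Proof.
apply: contrapT => /forallNP nA.
have l (a : A) : OpTable empty_mulA by case: (nA a).
by case: (w (@Label all_semigroups A (OpTable empty_mulA) I l)).
Qed.

(** Values lie in the subsemigroup generated by the letters, so within one finite semigroup a
    pseudoword can be treated as a word. *)
Lemma ev_ind T (l : A -> T) (P : T -> Prop) w :
  (forall a, P (l a)) -> (forall x y, P x -> P y -> P (x * y)) -> P (ev l w).
Proof.
move=> Pl PM; have [a0 _] := pseudoword_letter w.
apply: (@coord_generated all_semigroups A pseudovariety_all a0 w
  (@Label all_semigroups A (optable_of T) I (@to_table _ \o l))
  [set x | P (of_table x)]) => [a|x y Px Py] /=; first by rewrite to_tableK.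
by rewrite of_table_mul; exact: PM.
Qed.

Lemma ev_pair T T' (l : A -> T) (l' : A -> T') w :
  ev (fun a => (l a, l' a)) w = (ev l w, ev l' w).
Proof.
pose ll a := (l a, l' a).
have := ev_hom (fst : {multiplicative (T * T')%type -> T}) ll w.
have := ev_hom (snd : {multiplicative (T * T')%type -> T'}) ll w.
rewrite -/ll.
by case: (ev _ w) => x y /= -> ->.
Qed.

Lemma ev_ind2 T T' (l : A -> T) (l' : A -> T') (P : T -> T' -> Prop) w :
  (forall a, P (l a) (l' a)) ->
  (forall x x' y y', P x x' -> P y y' -> P (x * y) (x' * y')) ->
  P (ev l w) (ev l' w).
Proof.
move=> Pl PM; suff: P (ev l w, ev l' w).1 (ev l w, ev l' w).2 by [].
rewrite -ev_pair; apply: (ev_ind (P := fun x => P x.1 x.2)) => //.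
by move=> [x x'] [y y']; exact: PM.
Qed.

(** Two continuous homomorphisms that agree on the letters agree on the dense subsemigroup generated
    by them, hence everywhere. *)
Lemma hom_ev (S : finSemigroupType)
    (phi : {multiplicative pseudoword A -> S}) w :
  continuous (phi : pseudoword A -> discrete_topology S) ->
  phi w = ev (fun a => phi (free_gen _ a)) w.
Proof.
move=> /discrete_continuousP cphi; have [a0 _] := pseudoword_letter w.
set l := fun a => _.
have : closure [set v | phi v = ev l v] w.
  rewrite (generators_dense pseudovariety_all a0) // => [a|x y /= xE yE].
    by rewrite /= ev_gen.
  by rewrite !gmulfM xE yE.
pose i := @Label all_semigroups A (optable_of S) I (@to_table _ \o l).
move=> /(_ _ (filterI (cphi w) (Omega_nbhs w i))) [v [/= vE [<- vw]]].
by rewrite vE /ev -/i vw.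
Qed.

Definition content w : {set A} :=
  ev (fun a => finset.set1 a : set_semigroup A) w.

Lemma content_gen a : content (free_gen _ a) = finset.set1 a.
Proof. by rewrite /content ev_gen. Qed.

Lemma content_mul : {morph content : x y / x * y >-> x :|: y}.
Proof. by move=> x y; rewrite /content gmulfM. Qed.

Lemma content_neq0 w : content w <> finset.set0.
Proof.
apply: (ev_ind (P := fun C : set_semigroup A => C <> finset.set0)).
  move=> a; apply/eqP; apply/finset.set0Pn; exists a.
  by rewrite finset.set11.
by move=> x y x0 _ /eqP; rewrite finset.setU_eq0 => /andP[/eqP].
Qed.

Lemma content_ind T (l : A -> T) (P : {set A} -> T -> Prop) w :
  (forall a, P (finset.set1 a) (l a)) ->
  (forall C x D y, P C x -> P D y -> P (C :|: D) (x * y)) ->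
  P (content w) (ev l w).
Proof.
by move=> Pl PM; apply: (ev_ind2 (T := set_semigroup A) (P := P)).
Qed.

End EvaluationInduction.

(** * Reversal of pseudowords *)

Section Reversal.
Local Open Scope group_scope.
Variable A : finType.
Implicit Types v w : pseudoword A.

Lemma rev_compatible w : compatible (fun i : labelled all_semigroups A =>
  w (@Label all_semigroups A (opp_table (target i)) I (@label _ _ i))
    : target i).
Proof.
move=> i j h hl.
exact: (@Omega_coordP _ _ w
  (@Label all_semigroups A (opp_table (target i)) I (@label _ _ i))
  (@Label all_semigroups A (opp_table (target j)) I (@label _ _ j))
  (opp_mor h) hl).
Qed.

Definition reversal w : pseudoword A := MkOmega (rev_compatible w).

Lemma ev_reversal (t : optable) (l : A -> t) w :
  ev l (reversal w) = ev (l : A -> opp_table t) w.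
Proof. by rewrite !ev_table. Qed.

Lemma reversal_mul v w : reversal (v * w) = reversal w * reversal v.
Proof.
by apply: ev_ext => t l; rewrite ev_mul !ev_reversal ev_mul opp_mulE.
Qed.

Lemma reversal_gen a : reversal (free_gen _ a) = free_gen _ a.
Proof. by apply: ev_ext => t l; rewrite ev_reversal !ev_gen. Qed.

Lemma reversalK : involutive reversal.
Proof.
move=> w; apply: ev_ext => t l; rewrite !ev_reversal.
have idM : {morph (id : opp_table (opp_table t) -> t) : x y / x * y} by [].
pose h : {multiplicative opp_table (opp_table t) -> t} :=
  HB.pack (id : opp_table (opp_table t) -> t)
    (isMultiplicative.Build _ _ _ idM).
exact: (ev_hom h (l : A -> opp_table (opp_table t))).
Qed.

Lemma content_reversal w : content (reversal w) = content w.
Proof.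
pose t := optable_of (set_semigroup A).
have oM : {morph (id : opp_table t -> t) : x y / x * y}.
  move=> x y; rewrite opp_mulE; congr to_table; exact: finset.setUC.
pose h : {multiplicative opp_table t -> t} :=
  HB.pack (id : opp_table t -> t) (isMultiplicative.Build _ _ _ oM).
rewrite /content /ev; congr (@of_table (set_semigroup A) _).
exact: (@Omega_coordP _ _ w (@Label all_semigroups A (opp_table t) I _)
  (@Label all_semigroups A t I _) h).
Qed.

End Reversal.

(** * Left and right basic factorizations *)

Section FirstCover.
Local Open Scope group_scope.
Variables (A : finType) (B : {set A}).

Section Semigroup.
Variable T : finSemigroupType.

(* An element [(C, t, f)] stands for a word with content [C] and value [t].
   Reading it when the letters in [X] have already been seen, either the
   letters of [B] never become all seen, or they already are, and [f X = None];
   or [f X = Some (p, a, q)], where [a] is the letter that completes [B] and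
   [p], [q] are the values of what precedes and follows it. *)
Definition cover : Type :=
  ({set A} * T * {ffun {set A} -> option (option T * A * option T)})%type.

HB.instance Definition _ := Finite.copy cover
  ({set A} * T * {ffun {set A} -> option (option T * A * option T)})%type.

Definition cover_mul (u v : cover) : cover :=
  (u.1.1 :|: v.1.1, u.1.2 * v.1.2,
   [ffun X => match u.2 X with
     | Some (p, a, q) => Some (p, a, q * Some v.1.2)
     | None => if v.2 (X :|: u.1.1) is Some (p, a, q)
               then Some (Some u.1.2 * p, a, q) else None
     end]).

Lemma cover_mulA : associative cover_mul.
Proof.
move=> u v w; rewrite /cover_mul /=; congr (_, _, _).
- exact: finset.setUA.
- exact: mulgA.
apply/ffunP => X; rewrite !ffunE /=.
case: (u.2 X) => [[[p a] q]|]; first by rewrite -mulgA.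
case: (v.2 _) => [[[p a] q]|] //.
by rewrite finset.setUA; case: (w.2 _) => [[[p a] q]|] //; rewrite mulgA.
Qed.

HB.instance Definition _ := isSemigroup.Build cover cover_mulA.

Definition cover_letter (l : A -> T) (a : A) : cover :=
  (finset.set1 a, l a,
   [ffun X : {set A} => if ~~ (B \subset X) && (B \subset X :|: finset.set1 a)
     then Some (None, a, None) else None]).

(** Completion may be reported only if [B] was not yet covered and becomes covered. This is what
    stops an element from reporting one after its own content has been read. *)
Definition cover_wf (u : cover) : bool :=
  [forall X, (u.2 X != None) ==>
     ~~ (B \subset X) && (B \subset X :|: u.1.1)].

Lemma cover_wfP u X : cover_wf u -> u.2 X <> None ->
  ~~ (B \subset X) /\ (B \subset X :|: u.1.1).
Proof. by move=> /forallP/(_ X)/implyP H /eqP /H /andP. Qed.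

Lemma cover_wf_mul : mulg_closed cover_wf.
Proof.
move=> u v uw vw; apply/forallP => X; apply/implyP; rewrite /= ffunE.
case E: (u.2 X) => [[[p a] q]|].
  have [|nX XC] := @cover_wfP u X uw; first by rewrite E.
  by rewrite nX finset.setUA (fintype.subset_trans XC) ?finset.subsetUl.
case E': (v.2 _) => [[[p a] q]|] // _.
have [|nX XC] := @cover_wfP v (X :|: u.1.1) vw; first by rewrite E'.
rewrite finset.setUA XC andbT.
by apply: contra nX => BX; rewrite (fintype.subset_trans BX) ?finset.subsetUl.
Qed.

Definition wf_cover : finSemigroupType := sub_semigroup cover_wf_mul.

Definition wf_cover_val : {multiplicative wf_cover -> cover} :=
  @sub_val _ _ cover_wf_mul.

Lemma cover_letter_wf l a : cover_wf (cover_letter l a).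
Proof.
by apply/forallP => X; apply/implyP; rewrite /= ffunE; case: (_ && _).
Qed.

Definition wf_cover_value : {multiplicative wf_cover -> T} := HB.pack
  (fun u => (wf_cover_val u).1.2)
  (isMultiplicative.Build wf_cover T (fun u => (wf_cover_val u).1.2)
     (fun _ _ => erefl)).

(* A well-formed element whose letters have all been seen in [e] never
   completes [B] when read after [e]. *)
Lemma cover_absorb (e x : cover) : cover_wf x -> x.1.1 \subset e.1.1 ->
  e * x = x ->
  x = (e.1.1, x.1.2, [ffun X => if e.2 X is Some (p, a, q)
    then Some (p, a, q * Some x.1.2) else None]).
Proof.
move=> xw /finset.setUidPl xe ex; have E : cover_mul e x = x by [].
rewrite -[LHS]E /cover_mul xe; congr (_, _, _).
  by rewrite -{2}ex.
apply/ffunP => X; rewrite !ffunE; case: (e.2 X) => [[[p a] q]|] //.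
case E' : (x.2 _) => [[[p a] q]|] //.
have [|/negP nX] := @cover_wfP x (X :|: e.1.1) xw; first by rewrite E'.
by rewrite -finset.setUA xe.
Qed.

(** By [cover_absorb], an element fixed by [e] on the left and of no larger content is determined by
    [e] and its value in [T], as [DO_inter_cover] requires. *)
Lemma DO_inter_wf_cover (H : semigroup_class) :
  DO_inter H T -> DO_inter H wf_cover.
Proof.
apply: (@DO_inter_cover H _ _ wf_cover_value A (fun u => (wf_cover_val u).1.1)).
  by [].
move=> e x y _ xe ye ex ey; rewrite /wf_cover_value /= => xy.
have wfv (u : wf_cover) : cover_wf (wf_cover_val u) by exact: (valP u).
have ex' : wf_cover_val e * wf_cover_val x = wf_cover_val x.
  by rewrite -gmulfM ex.
have ey' : wf_cover_val e * wf_cover_val y = wf_cover_val y.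
  by rewrite -gmulfM ey.
apply: (val_inj (sT := wf_cover)).
change (wf_cover_val x = wf_cover_val y).
rewrite (cover_absorb (wfv x) xe ex') (cover_absorb (wfv y) ye ey') .
by rewrite xy.
Qed.

Definition split_at (l : A -> T) (w : pseudoword A) :
    option (option T * A * option T) :=
  (ev (cover_letter l) w).2 finset.set0.

Lemma split_at_wf (l : A -> T) (w : pseudoword A) :
  split_at l w = (wf_cover_val (ev (fun a => Sub (cover_letter l a)
    (cover_letter_wf l a) : wf_cover) w)).2 finset.set0.
Proof.
by rewrite ev_hom.
Qed.

End Semigroup.

Definition map_split (T T' : Type) (h : T -> T')
  (x : option (option T * A * option T)) :=
  omap (fun pq => (omap h pq.1.1, pq.1.2, omap h pq.2)) x.

(** The cover construction is functorial in [T]. This naturality lets the factors found in finite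
    semigroups assemble into pseudowords. *)
Lemma split_at_hom (T T' : finSemigroupType) (h : {multiplicative T -> T'})
    (l : A -> T) (w : pseudoword A) :
  split_at (h \o l) w = map_split h (split_at l w).
Proof.
pose g (u : cover T) : cover T' :=
  (u.1.1, h u.1.2, [ffun X => map_split h (u.2 X)]).
have hM : {morph h : x y / x * y} by exact: gmulfM.
have gM : {morph g : x y / x * y}.
  move=> u v; congr (_, _, _); first by rewrite /= gmulfM.
  apply/ffunP => X; rewrite !ffunE /=.
  case: (u.2 X) => [[[p a] q]|] /=; first by rewrite omap_mul.
  by case: (v.2 _) => [[[p a] q]|] //=; rewrite omap_mul.
pose g' : {multiplicative cover T -> cover T'} :=
  HB.pack g (isMultiplicative.Build _ _ _ gM).
have -> : map_split h (split_at l w) =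
    (g' (ev (cover_letter l) w)).2 finset.set0.
  by rewrite /= ffunE.
rewrite ev_hom /split_at.
have -> // : g' \o cover_letter l = cover_letter (h \o l).
apply/funext => a; congr (_, _, _); apply/ffunP => X.
by rewrite !ffunE; case: ifP.
Qed.

Lemma split_at_value (T : finSemigroupType) (l : A -> T) (w : pseudoword A)
    p a q :
  split_at l w = Some (p, a, q) -> Some (ev l w) = p * Some (l a) * q.
Proof.
pose P (u : cover T) (t : T) := u.1.2 = t /\ forall X p a q,
  u.2 X = Some (p, a, q) -> Some t = p * Some (l a) * q.
have H : P (ev (cover_letter l) w) (ev l w).
  apply: ev_ind2 => [b|u t v t' [ut Pu] [vt Pv]].
    by split=> // X p' a' q'; rewrite ffunE; case: ifP => // _ [<- <- <-].
  split=> [|X p' a' q']; first by rewrite -ut -vt.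
  rewrite ffunE; case E : (u.2 X) => [[[p1 a1] q1]|].
    by move=> [<- <- <-]; rewrite mulgA -(Pu _ _ _ _ E) vt.
  case E' : (v.2 _) => [[[p1 a1] q1]|] // [<- <- <-].
  by rewrite -!mulgA (mulgA p1) -(Pv _ _ _ _ E') ut.
exact: H.2.
Qed.

Lemma split_at_ex (T : finSemigroupType) (l : A -> T) (w : pseudoword A) :
  B != finset.set0 -> B \subset content w -> split_at l w <> None.
Proof.
(* The invariant allows any set [X] of letters already seen, because a second factor is read after
   the content of the first. *)
move=> B0; pose P (C : {set A}) (u : cover T) := u.1.1 = C /\
  forall X : {set A}, ~~ (B \subset X) -> B \subset X :|: C -> u.2 X <> None.
have H : P (content w) (ev (cover_letter l) w).
  apply: content_ind => [b|C u D v [uC Pu] [vD Pv]].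
    by split=> // X nX XC; rewrite ffunE nX XC.
  split=> [|X nX XCD]; first by rewrite -uC -vD.
  rewrite ffunE; case E : (u.2 X) => [[[p1 a1] q1]|] //.
  have /(_ (X :|: C)) := Pv; rewrite uC.
  case: (v.2 _) => [[[p1 a1] q1]|] // [] //.
    by apply/negP => XC; apply: (Pu _ nX XC E).
  by rewrite -finset.setUA.
move=> BC; apply: H.2; last by rewrite finset.set0U.
by rewrite finset.subset0.
Qed.

Definition oset (x : option (set_semigroup A)) : {set A} := odflt finset.set0 x.

Lemma split_at_content (w : pseudoword A) p a q :
  split_at (fun a => finset.set1 a : set_semigroup A) w = Some (p, a, q) ->
  ~~ (B \subset oset p) /\ B \subset oset p :|: finset.set1 a.
Proof.
pose P (C : set_semigroup A) (u : cover (set_semigroup A)) :=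
  [/\ u.1.1 = C, u.1.2 = C & forall (X : {set A}) p a q,
  u.2 X = Some (p, a, q) ->
   ~~ (B \subset X :|: oset p) /\ B \subset X :|: oset p :|: finset.set1 a].
have H : P (content w)
    (ev (cover_letter (fun a => finset.set1 a : set_semigroup A)) w).
  apply: ev_ind2 => [b|C u D v [uC uC' Pu] [vD vD' Pv]].
    split=> // X p' a' q'; rewrite ffunE.
    case: ifP => // /andP[nX XB] [<- <- _].
    by rewrite finset.setU0.
  split=> [||X p' a' q']; [by rewrite -uC -vD|by rewrite -uC' -vD'|].
  rewrite ffunE; case E : (u.2 X) => [[[p1 a1] q1]|].
    by move=> [<- <- _]; exact: (Pu _ _ _ _ E).
  case E' : (v.2 _) => [[[p1 a1] q1]|] // [<- <- _].
  have := Pv _ _ _ _ E'; rewrite uC.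
  have -> // : oset (Some u.1.2 * p1) = C :|: oset p1.
    by rewrite uC'; case: (p1) => //=; rewrite finset.setU0.
  by rewrite !finset.setUA.
have [_ _ H'] := H; move=> /H' /=.
by rewrite finset.set0U.
Qed.

End FirstCover.

(** * Basic factorizations of pseudowords and their uniqueness *)

Section LeftBasic.
Local Open Scope group_scope.
Variable A : finType.
Implicit Types (w : pseudoword A) (x y : option (pseudoword A)).

(** A natural family of values is a pseudoword or empty throughout: the map to the trivial semigroup
    decides which. *)
Lemma opt_pseudoword (a0 : A)
    (F : forall T : finSemigroupType, (A -> T) -> option T) :
  (forall (T T' : finSemigroupType) (h : {multiplicative T -> T'}) l,
    F T' (h \o l) = omap h (F T l)) ->
  exists x, forall (T : finSemigroupType) (l : A -> T), omap (ev l) x = F T l.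
Proof.
move=> Fh; pose t0 : trivial_table := ord0.
case F0 : (F trivial_table (fun=> t0)) => [s|]; last first.
  exists None => T l; have := Fh _ _ (to_trivial T) l.
  by rewrite /comp /= F0; case: (F T l).
(* In this case [F] is [Some] everywhere, since its image in the trivial semigroup is; [a0] supplies
   the default of [odflt]. *)
have wc : compatible (fun i : labelled all_semigroups A =>
    odflt (label i a0) (F (target i) (@label _ _ i))).
  move=> i j h hl; rewrite -hl.
  have -> : F (target j) (@label _ _ j) = omap h (F (target i) (@label _ _ i)).
    by rewrite -Fh; congr F; apply/funext => a; rewrite /= hl.
  by case: (F (target i) _).
exists (Some (MkOmega wc)) => T l; rewrite /= /ev /= Fh.
have := Fh _ _ (to_trivial T) l; rewrite /comp /= F0.
by case: (F T l) => //= t _; rewrite to_tableK.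
Qed.

(** Prefix and suffix come from [opt_pseudoword]; the letter is the same in all semigroups by
    comparison with the trivial one. *)
Lemma split_at_pseudoword w : exists x a y,
  forall (T : finSemigroupType) (l : A -> T),
    split_at (content w) l w = Some (omap (ev l) x, a, omap (ev l) y).
Proof.
have [a0 _] := pseudoword_letter w; set B := content w.
have B0 : B != finset.set0 by apply/eqP; exact: content_neq0.
have ex (T : finSemigroupType) (l : A -> T) :
    exists pq, split_at B l w = Some pq.
  have := @split_at_ex A B T l w B0 (fintype.subxx _).
  by case: split_at => // pq _; exists pq.
have [|x xP] := @opt_pseudoword a0
  (fun T l => obind (fun pq => pq.1.1) (split_at B l w)).
  by move=> T T' h l; rewrite split_at_hom; case: split_at.
have [|y yP] := @opt_pseudoword a0
  (fun T l => obind (fun pq => pq.2) (split_at B l w)).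
  by move=> T T' h l; rewrite split_at_hom; case: split_at.
have [[[p a] q] E] := ex trivial_table (fun=> ord0).
exists x, a, y => T l; rewrite xP yP.
have := split_at_hom B (to_trivial T) l w; rewrite /comp /= E.
by have [[[p' a'] q'] ->] := ex T l => -[_ -> _].
Qed.

Definition ocontent x : {set A} :=
  if x is Some w then content w else finset.set0.

Lemma ocontent_mul : {morph ocontent : x y / x * y >-> x :|: y}.
Proof.
case=> [v|] [w|] //=; rewrite ?finset.set0U ?finset.setU0 //.
exact: content_mul.
Qed.

Lemma oev_content x :
  oset (omap (ev (fun a => finset.set1 a : set_semigroup A)) x) = ocontent x.
Proof. by case: x. Qed.

Lemma left_basic w x a y :
  (forall (T : finSemigroupType) (l : A -> T),
    split_at (content w) l w = Some (omap (ev l) x, a, omap (ev l) y)) ->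
  [/\ Some w = x * Some (free_gen _ a) * y,
    ~~ (content w \subset ocontent x) &
    ocontent x :|: finset.set1 a = content w].
Proof.
move=> sp.
have wE : Some w = x * Some (free_gen _ a) * y.
  have E (T : finSemigroupType) (l : A -> T) :
      Some (ev l w) = omap (ev l) x * Some (l a) * omap (ev l) y.
    exact: split_at_value (sp T l).
  by case: x y E {sp} => [x|] [y|] /= E; rewrite ?omul0x ?omulx0 ?omulSS;
    congr Some; apply: ev_ext => t l; have := E t l;
    rewrite ?omul0x ?omulx0 ?omulSS ?ev_mul ev_gen => -[].
have := split_at_content (sp _ _).
rewrite oev_content.
move=> [nBx Bx]; split=> //; apply/eqP; rewrite finset.eqEsubset Bx andbT.
have : ocontent (Some w) = ocontent x :|: finset.set1 a :|: ocontent y.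
  by rewrite wE !ocontent_mul /= content_gen.
by move=> /= ->; exact: finset.subsetUl.
Qed.

Section Equivalence.
Variable V : semigroup_class.

(** Equality of projections to the free pro-[V] semigroup, extended to factors that may be empty. *)
Definition veq x y := forall T : finSemigroupType, V T ->
  forall l : A -> T, omap (ev l) x = omap (ev l) y.

Lemma veq_mul x x' y y' : veq x x' -> veq y y' -> veq (x * y) (x' * y').
Proof.
move=> xx yy T VT l; rewrite !(omap_mul (ev_mul l)).
by rewrite xx // yy.
Qed.

End Equivalence.

Section Uniqueness.
Variable H : semigroup_class.
Hypothesis pvH : pseudovariety_of_groups H.

Lemma veq_content x y : veq (DO_inter H) x y -> ocontent x = ocontent y.
Proof.
move=> /(_ (set_semigroup A) (DO_inter_set A pvH)) xy.
by rewrite -!oev_content xy.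
Qed.

(** The triple is read off the value of [w] in [wf_cover], which lies in [DO_inter H] whenever [T]
    does. *)
Lemma left_basic_unique (B : {set A}) w x a y w' x' a' y' :
  (forall (T : finSemigroupType) (l : A -> T),
    split_at B l w = Some (omap (ev l) x, a, omap (ev l) y)) ->
  (forall (T : finSemigroupType) (l : A -> T),
    split_at B l w' = Some (omap (ev l) x', a', omap (ev l) y')) ->
  veq (DO_inter H) (Some w) (Some w') ->
  [/\ veq (DO_inter H) x x', a = a' & veq (DO_inter H) y y'].
Proof.
move=> sp sp' ww.
have E (T : finSemigroupType) (l : A -> T) : DO_inter H T ->
    Some (omap (ev l) x, a, omap (ev l) y) =
    Some (omap (ev l) x', a', omap (ev l) y').
  move=> HT; rewrite -sp -sp' !split_at_wf.
  by have [->] := ww _ (DO_inter_wf_cover B HT)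
    (fun a => Sub (cover_letter B l a) (cover_letter_wf B l a)).
split.
- by move=> T HT l; case: (E T l HT).
- by case: (E trivial_table (fun=> ord0) (DO_inter_trivial pvH)).
- by move=> T HT l; case: (E T l HT).
Qed.

Section Tuples.
Variables (I : Type) (i0 : I).
Implicit Types u v : I -> option (pseudoword A).

Definition vconst u := forall i j, veq (DO_inter H) (u i) (u j).

Lemma vconst_content u i j : vconst u -> ocontent (u i) = ocontent (u j).
Proof. by move=> /(_ i j) /veq_content. Qed.

Lemma left_step u : vconst u -> ocontent (u i0) != finset.set0 ->
  exists (x : I -> option (pseudoword A)) a (y : I -> option (pseudoword A)),
  [/\ vconst x, vconst y,
    forall i, u i = x i * Some (free_gen _ a) * y i &
    ~~ (ocontent (u i0) \subset ocontent (x i0)) /\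
    ocontent (x i0) :|: finset.set1 a = ocontent (u i0)].
Proof.
move=> uc B0; have uS i : exists w, u i = Some w.
  move: B0; rewrite -(vconst_content i i0 uc).
  by case: (u i) => [w|]; [exists w|rewrite eqxx].
have [w wE] := choice uS.
have cE i : ocontent (u i0) = content (w i).
  by rewrite (vconst_content i0 i uc) wE.
have /choice[x] := fun i => split_at_pseudoword (w i).
move=> /choice[a] /choice[y sp].
have U i j : [/\ veq (DO_inter H) (x i) (x j), a i = a j &
    veq (DO_inter H) (y i) (y j)].
  apply: (@left_basic_unique (ocontent (u i0)) (w i) _ _ _ (w j)).
  - by rewrite (cE i).
  - by rewrite (cE j).
  - by rewrite -!wE.
exists x, (a i0), y; split.
- by move=> i j; case: (U i j).
- by move=> i j; case: (U i j).
- by move=> i; have [_ <- _] := U i i0; have [<- _ _] := left_basic (sp i).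
- by rewrite (cE i0); have [] := left_basic (sp i0).
Qed.

Lemma veq_reversal x y : veq (DO_inter H) x y ->
  veq (DO_inter H) (omap (@reversal A) x) (omap (@reversal A) y).
Proof.
move=> xy T HT l.
have := xy _ (DO_inter_opp (DO_inter_optable_of HT)) (@to_table _ \o l).
have E (z : pseudoword A) :
    ev (T := opp_table (optable_of T)) (@to_table _ \o l) z =
    to_table (ev l (reversal z)).
  by rewrite ev_hom -ev_reversal.
case: x y {xy} => [x|] [y|] //=; rewrite !E.
by move=> -[/(can_inj (@to_tableK T)) ->].
Qed.

Lemma ocontent_reversal x : ocontent (omap (@reversal A) x) = ocontent x.
Proof. by case: x => //= w; exact: content_reversal. Qed.

(** Apply [left_step] to the reversed tuple; [DO_inter H] is closed under opposites. *)
Lemma right_step u : vconst u -> ocontent (u i0) != finset.set0 ->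
  exists (x : I -> option (pseudoword A)) a (y : I -> option (pseudoword A)),
  [/\ vconst x, vconst y,
    forall i, u i = y i * (Some (free_gen _ a) * x i) &
    ~~ (ocontent (u i0) \subset ocontent (x i0)) /\
    ocontent (x i0) :|: finset.set1 a = ocontent (u i0)].
Proof.
move=> uc B0; pose u' i := omap (@reversal A) (u i).
have u'c : vconst u' by move=> i j; exact: veq_reversal.
have [|x [a [y [xc yc uE [nx xa]]]]] := left_step u'c.
  by rewrite ocontent_reversal.
exists (fun i => omap (@reversal A) (x i)), a,
  (fun i => omap (@reversal A) (y i)); split.
- by move=> i j; exact: veq_reversal.
- by move=> i j; exact: veq_reversal.
- move=> i; have -> : u i = omap (@reversal A) (u' i).
    by rewrite /u'; case: (u i) => //= w; rewrite reversalK.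
  rewrite uE; case: (x i) => [v|]; case: (y i) => [w|] /=;
    by rewrite ?omul0x ?omulx0 /= ?reversal_mul ?reversal_gen.
- by rewrite !ocontent_reversal in nx xa *.
Qed.

End Tuples.
End Uniqueness.
End LeftBasic.

(** * The induction *)

(** Iterate the step. Two of the partial products have the same image in the finite [M]: [g] is the
    shorter one and [g'] the product of the steps in between. *)
Lemma pigeonhole_loop (G R : Type) (M : finType) (op : G -> G -> G) (e : G -> M)
    (PG : G -> Prop) (PR : R -> Prop) (rel : R -> G -> R -> Prop) :
  associative op -> (forall g g', PG g -> PG g' -> PG (op g g')) ->
  (forall r, PR r -> exists g r', [/\ PG g, PR r' & rel r g r']) ->
  (forall r g r' g' r'', rel r g r' -> rel r' g' r'' -> rel r (op g g') r'') ->
  forall r, PR r -> exists g g' r',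
    [/\ PG g, PG g', PR r', rel r g r' & e (op g g') = e g].
Proof.
move=> opA PGM step relM r rP; have [g0 [_ [_ _ _]]] := step r rP.
(* Choice needs a total function, so a dummy pair is given outside [PR]. *)
have /choice[next nextP] : forall r1, exists gr : G * R, PR r1 ->
    [/\ PG gr.1, PR gr.2 & rel r1 gr.1 gr.2].
  move=> r1; have [/step[g [r' gr]]|nr] := pselect (PR r1).
    by exists (g, r').
  by exists (g0, r1).
(* [x k] holds the product of the first [k.+1] factors and what remains after them. *)
pose x := fix x k : G * R := if k is k'.+1
  then (op (x k').1 (next (x k').2).1, (next (x k').2).2) else next r.
have xP k : [/\ PG (x k).1, PR (x k).2 & rel r (x k).1 (x k).2].
  elim: k => [|k [xG xR xr]]; first exact: nextP.
  by have [nG nR nr] := nextP _ xR; split=> //=; [exact: PGM|exact: relM nr].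
have xD j d : exists2 g, PG g & (x (j + d).+1).1 = op (x j).1 g.
  elim: d => [|d [g gP xE]].
    rewrite addn0; have [_ /nextP[nG _ _] _] := xP j.
    by exists (next (x j).2).1.
  have [_ /nextP[nG _ _] _] := xP (j + d).+1.
  rewrite addnS; exists (op g (next (x (j + d).+1).2).1); first exact: PGM.
  by rewrite opA -xE.
have [i [j [ij eij]]] : exists i j, (i < j)%N /\ e (x i).1 = e (x j).1.
  have /injectivePn[i [j neq_ij eq_ij]] :
      ~~ injectiveb (fun i : 'I_#|M|.+1 => e (x i).1).
    by apply/negP => /injectiveP /leq_card; rewrite card_ord ltnn.
  have [lt_ij|lt_ji|/val_inj ij] := ltngtP i j.
  - by exists i, j.
  - by exists j, i.
  - by rewrite ij eqxx in neq_ij.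
have [g gP xE] := xD i (j - i.+1)%N; have [iG iR ir] := xP i.
exists (x i).1, g, (x i).2; split=> //.
by rewrite -xE eij -addSn subnKC.
Qed.

Section OmegaPower.
Local Open Scope group_scope.
Variable A : finType.

Definition omega (w : pseudoword A) : pseudoword A :=
  subst (fun=> w) (MkOmega omega_compatible).

Lemma ev_omega (T : finSemigroupType) (l : A -> T) w :
  ev l (omega w) = omega_power (ev l w).
Proof. by rewrite ev_subst {1}/ev /= omega_power_hom /= to_tableK. Qed.

Lemma content_omega w : content (omega w) = content w.
Proof.
rewrite /content ev_omega.
exact: (@idempotent_powS (set_semigroup A) _ _ (finset.setUid _)).
Qed.

End OmegaPower.

Section OmegaAbsorb.
Local Open Scope group_scope.
Variable T : finSemigroupType.

Lemma omega_absorbr (s : option T) (t : T) :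
  s * Some t = s -> s * Some (omega_power t) = s.
Proof.
move=> st; rewrite /omega_power; elim: _.-1 => //= n IH.
by rewrite -omulSS mulgA st.
Qed.

Lemma omega_absorbl (s : option T) (t : T) :
  Some t * s = s -> Some (omega_power t) * s = s.
Proof.
move=> st; rewrite /omega_power; elim: _.-1 => //= n IH.
by rewrite -omulSS -mulgA IH.
Qed.

Lemma J_le_omega (e t : T) : J_orthodox T -> is_idempotent e -> J_le e t ->
  J_le e (omega_power t).
Proof.
move=> oT ee et; rewrite /omega_power; elim: _.-1 => //= n IH.
exact: J_le_idem_mul.
Qed.

Lemma omega_J_le (t : T) : J_le (omega_power t) t.
Proof.
rewrite /omega_power; case: _.-1 => [|n]; first exact: J_le_refl.
exact: J_le_mulr.
Qed.

End OmegaAbsorb.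

Section Restriction.
Local Open Scope group_scope.
Variables (A : finType) (B : {set A}).

(** Reduction over [H] takes place over this subalphabet, so that the new middle factor contains no
    letter outside [B]. *)
Definition letters : finType := {a : A | a \in B}.

Definition of_letters (w : pseudoword letters) : pseudoword A :=
  subst (fun b => free_gen _ (val b)) w.

Lemma ev_of_letters (T : finSemigroupType) (l : A -> T) w :
  ev l (of_letters w) = ev (l \o val) w.
Proof.
by rewrite ev_subst; congr (ev _ w); apply/funext => b; rewrite ev_gen.
Qed.

Lemma content_of_letters w : content (of_letters w) \subset B.
Proof.
rewrite /content ev_of_letters.
apply: (ev_ind (P := fun C : set_semigroup A => C \subset B)) => [b|x y xB yB].
  by rewrite finset.sub1set (valP b).
by rewrite finset.subUset xB.
Qed.

Lemma ev_eq_in (T : finSemigroupType) (l l' : A -> T) w :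
  (forall a, a \in content w -> l a = l' a) -> ev l w = ev l' w.
Proof.
pose P (C : {set A}) (t : T * T) :=
  (forall a, a \in C -> l a = l' a) -> t.1 = t.2.
suff : P (content w) (ev (fun a => (l a, l' a)) w) by rewrite ev_pair.
apply: content_ind => [a|C x D y CP DP] h.
  by apply: h; rewrite finset.set11.
congr (_ * _); [apply: CP|apply: DP] => a aCD.
all: by apply: h; rewrite finset.inE aCD ?orbT.
Qed.

Variable b0 : letters.

(** Letters outside [B] are sent to [b0]; values are preserved when the content lies in [B]. *)
Definition retract (w : pseudoword A) : pseudoword letters :=
  subst (fun a => free_gen _ (insubd b0 a)) w.

Lemma ev_retract (T : finSemigroupType) (l : letters -> T) w :
  ev l (retract w) = ev (fun a => l (insubd b0 a)) w.
Proof.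
by rewrite ev_subst; congr (ev _ w); apply/funext => b; rewrite ev_gen.
Qed.

Lemma retractK (T : finSemigroupType) (l : A -> T) w : content w \subset B ->
  ev (l \o val) (retract w) = ev l w.
Proof.
move=> wB; rewrite ev_retract; apply: ev_eq_in => a /(fintype.subsetP wB) aB /=.
by congr l; exact: (insubdK b0 aB).
Qed.

End Restriction.

Lemma p_proj_eqP (V : semigroup_class) (A : finType) (v w : pseudoword A) :
  (forall T : finSemigroupType, V T -> V (optable_of T)) ->
  p_proj V v = p_proj V w <->
  forall T : finSemigroupType, V T -> forall l : A -> T, ev l v = ev l w.
Proof.
move=> Vt; split=> [/p_proj_eq vw T VT l|vw]; last first.
  by apply/p_proj_eq => t l /vw.
by apply: (can_inj (@to_tableK T)); rewrite !ev_hom vw //; exact: Vt.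
Qed.

Section Middle.
Local Open Scope group_scope.
Variable H : semigroup_class.

(* Between idempotents [e], [f] of full content the value of [m] is determined
   by its value in a group of [H]: [t |-> e * t * e] is a homomorphism from the
   elements above [e] to the maximal subgroup at [e]. *)
Lemma middle_eq (A : finType) (B : {set A}) (T : finSemigroupType) (l : A -> T)
    (y z : pseudoword A) (m m' : pseudoword (letters B)) :
  DO_inter H T -> content y = B -> content z = B ->
  (forall G : finSemigroupType, H G -> forall k : letters B -> G,
     ev k m = ev k m') ->
  ev l (omega y * of_letters m * omega z) =
  ev l (omega y * of_letters m' * omega z).
Proof.
move=> [/DO_orthodox oT gT] yB zB mm.
rewrite !ev_mul !ev_omega !ev_of_letters.
have above (v : pseudoword A) : content v = B -> forall a, a \in B ->
    J_le (omega_power (ev l v)) (l a).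
  move=> <- a av; apply: J_le_trans (omega_J_le _) _; move: a av.
  apply: (content_ind (P := fun C t => forall a, a \in C -> J_le t (l a))).
    by move=> b a; rewrite finset.inE => /eqP ->; exact: J_le_refl.
  move=> C x D t Cx Dt a; rewrite finset.inE => /orP[/Cx|/Dt] h.
    by apply: J_le_trans h; exact: J_le_mulr.
  by apply: J_le_trans h; exact: J_le_mull.
have idem v : is_idempotent (omega_power (ev l v)) := omega_power_idempotent _.
(* The elements above an idempotent are closed under products, so it suffices to look at letters; by
   symmetry the two omega powers are J-equivalent. *)
have aboveE v v' : content v = B -> content v' = B ->
    J_le (omega_power (ev l v)) (omega_power (ev l v')).
  move=> vB v'B; apply: J_le_omega => //.
  have : content v' \subset B by rewrite v'B.
  apply: (content_ind (P := fun C t => C \subset B -> J_le _ t)).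
    by move=> a; rewrite finset.sub1set; exact: above.
  move=> C x D t Cx Dt; rewrite finset.subUset => /andP[/Cx ? /Dt ?].
  exact: J_le_idem_mul.
have ef : J_idem (omega_power (ev l y)) (omega_power (ev l z)).
  by split; [exact: idem|exact: aboveE|exact: aboveE].
move: (omega_power (ev l y)) (omega_power (ev l z)) (idem y) ef (above y yB).
move=> e f ee ef el {above idem aboveE}.
have eG (b : letters B) : in_local_group e (e * l (val b) * e).
  by apply: in_local_groupP => //; apply: el; exact: (valP b).
pose k b : local_group e := Sub _ (eG b).
have K (w : pseudoword (letters B)) : J_le e (ev (l \o val) w) /\
    local_val (ev k w) = e * ev (l \o val) w * e.
  apply: (ev_ind2 (P := fun t (g : local_group e) =>
    J_le e t /\ local_val g = e * t * e)) => [b|t g t' g' [et gE] [et' gE']].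
    by split; [exact: el (valP b)|exact: SubK].
  by split; [exact: J_le_idem_mul|rewrite gmulfM gE gE' J_idem_bimul].
have Hk : H (local_group e).
  by apply: (gT _ local_val (is_group_local ee)) => //; exact: local_val_inj.
have [em mE] := K m; have [em' mE'] := K m'.
(* Inserting [e] before [f] leaves the local value [e * m * e], which is a value in a group of
   [H]. *)
by rewrite (J_idem_absorb oT ee ef em) (J_idem_absorb oT ee ef em') -mE -mE' mm.
Qed.

End Middle.

Section Signature.
Local Open Scope group_scope.
Variable A : finType.
Implicit Types (sigma : set implicit_op) (v w : pseudoword A).

Lemma sigma_generated_sub sigma sigma' w : sigma `<=` sigma' ->
  sigma_generated sigma w -> sigma_generated sigma' w.
Proof.
move=> ss'; elim=> [a|k u v uS _ vS]; first exact: sigma_gen.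
by apply: sigma_op => //; exact: ss'.
Qed.

Lemma sigma_generated_mul sigma v w : implicit_signature sigma ->
  sigma_generated sigma v -> sigma_generated sigma w ->
  sigma_generated sigma (v * w).
Proof.
move=> sM vS wS; pose f (i : 'I_2) := if i == ord0 then v else w.
have <- : subst f (projT2 mul_op) = v * w by rewrite subst_mul !subst_gen.
by apply: sigma_op => // i; rewrite /f; case: ifP.
Qed.

Lemma sigma_generated_omega sigma w : sigma omega_op ->
  sigma_generated sigma w -> sigma_generated sigma (omega w).
Proof. by move=> sO wS; exact: sigma_op. Qed.

Lemma sigma_generated_subst (B : finType) sigma (f : B -> pseudoword A)
    (w : pseudoword B) : (forall b, sigma_generated sigma (f b)) ->
  sigma_generated sigma w -> sigma_generated sigma (subst f w).
Proof.
move=> fS; elim=> [b|k u v uS _ vS]; first by rewrite subst_gen.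
have -> : subst f (subst v u) = subst (fun i => subst f (v i)) u.
  by apply: Omega_eq.
exact: sigma_op.
Qed.

End Signature.

(** * Reduction in the groups of [H] *)

Section GroupReduction.
Local Open Scope group_scope.
Variables (H : semigroup_class) (sigma0 : set implicit_op).
Hypotheses (pvH : pseudovariety_of_groups H)
  (red0 : pointlike_reducible H sigma0).
Variables (S : finSemigroupType) (B : finType) (lam : B -> S).
Variables (I : Type) (i0 : I) (r : I -> pseudoword B).
Hypothesis rH : forall i j (G : finSemigroupType), H G -> forall k : B -> G,
  ev k (r i) = ev k (r j).

(** Reducibility concerns onto homomorphisms, so [S] is cut down to the image of evaluation. *)
Definition is_value (s : S) : bool := `[< exists w, ev lam w = s >].

Lemma is_value_mul : mulg_closed is_value.
Proof.
move=> _ _ /asboolP[v <-] /asboolP[w <-]; apply/asboolP.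
by exists (v * w); rewrite ev_mul.
Qed.

Definition values : finSemigroupType := sub_semigroup is_value_mul.
Definition values_val : {multiplicative values -> S} :=
  @sub_val _ _ is_value_mul.

Lemma is_value_ev w : is_value (ev lam w).
Proof. by apply/asboolP; exists w. Qed.

Definition to_values (w : pseudoword B) : values := Sub _ (is_value_ev w).

Lemma to_values_mul : {morph to_values : x y / x * y}.
Proof. by move=> x y; apply: val_inj; exact: ev_mul. Qed.

HB.instance Definition _ := isMultiplicative.Build _ _ to_values to_values_mul.

Lemma onto_continuous_to_values : onto_continuous to_values.
Proof.
split=> [|s].
  apply/discrete_continuousP => w.
  apply: filterS (Omega_nbhs w (@Label all_semigroups B (optable_of S) Logic.I
    (@to_table _ \o lam))) => v /= vw.
  by apply: val_inj; rewrite /= /ev vw.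
have /asboolP[w wE] := valP s.
by exists w; apply: val_inj.
Qed.

(** For another alphabet [C], lift the letters of [B] along [psi] and substitute the lifts in the
    [r i]; equality over [H] survives substitution. *)
Lemma pointlike_values : pointlike H (range (to_values \o r)).
Proof.
split; first by exists (to_values (r i0)), i0.
move=> C psi [cpsi opsi].
have /choice[v vE] : forall b, exists v, psi v = to_values (free_gen _ b).
  by move=> b; exact: opsi.
have psiE w : psi (subst v w) = to_values w.
  rewrite hom_ev // ev_subst; have [ct _] := onto_continuous_to_values.
  rewrite (hom_ev (phi := to_values) w ct); congr (ev _ w); apply/funext => b.
  by rewrite -hom_ev.
exists (range (fun i => subst v (r i))); split.
  apply/seteqP; split=> [_ [_ [i _ <-] <-]|_ [i _ <-]].
    by exists i => //; rewrite /= psiE.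
  by exists (subst v (r i)); [exists i|exact: psiE].
exists (p_proj H (subst v (r i0))); apply/seteqP.
split=> [_ [_ [i _ <-] <-]|_ ->]; last first.
  by exists (subst v (r i0)); first by exists i0.
by apply/p_proj_eq => t l Ht; rewrite !ev_subst; exact: rH.
Qed.

Lemma group_reduction : exists m : I -> pseudoword B,
  [/\ forall i, sigma_generated sigma0 (m i),
    forall i, ev lam (m i) = ev lam (r i) &
    forall i j (G : finSemigroupType), H G -> forall k : B -> G,
      ev k (m i) = ev k (m j)].
Proof.
have [P' P's [P'E [v vE]]] := red0 pointlike_values onto_continuous_to_values.
have /choice[m mP] : forall i, exists m, P' m /\ to_values m = to_values (r i).
  move=> i; have : range (to_values \o r) (to_values (r i)) by exists i.
  by rewrite -P'E => -[m Pm mE]; exists m.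
exists m; split=> [i|i|i j].
- by apply: P's; case: (mP i).
- by have [_ /(congr1 values_val)] := mP i.
apply/p_proj_eqP; first by move=> T; exact: pv_optable_of pvH.1.
have pE k : p_proj H (m k) = v.
  have : (@p_proj H B @` P') (p_proj H (m k)) by exists (m k); [case: (mP k)|].
  by rewrite vE.
by rewrite !pE.
Qed.

End GroupReduction.

Section Sided.
Local Open Scope group_scope.
Variable T : semigroupType.

(* Multiplication in [T] or, for [b = true], in its opposite: the left and the
   right versions of the factorization argument are done at once. *)
Definition mulb (b : bool) (x y : T) : T := if b then y * x else x * y.

Lemma mulbA b : associative (mulb b).
Proof. by case: b => x y z; rewrite /mulb mulgA. Qed.

End Sided.

(** * Replacing both ends and the middle *)

Section Main.
Local Open Scope group_scope.
Variables (H : semigroup_class) (sigma0 : set implicit_op).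
Hypotheses (pvH : pseudovariety_of_groups H)
  (sig0 : implicit_signature sigma0) (red0 : pointlike_reducible H sigma0).
Variables (S : finSemigroupType) (A : finType) (lam : A -> S).
Variables (I : finType) (i0 : I).
Implicit Types u v w x y : I -> option (pseudoword A).

Let sigma : set implicit_op := sigma0 `|` [set omega_op].
Let oev (x : option (pseudoword A)) : option S := omap (ev lam) x.

Let oevM : {morph oev : x y / x * y}.
Proof. exact: omap_mul (ev_mul lam). Qed.

Let sigM : implicit_signature sigma. Proof. by left. Qed.

Definition osigma (x : option (pseudoword A)) : Prop :=
  if x is Some w then sigma_generated sigma w else True.

Lemma osigma_mul (x y : option (pseudoword A)) :
  osigma x -> osigma y -> osigma (x * y).
Proof. by case: x y => [x|] [y|] //; exact: sigma_generated_mul. Qed.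

Section Mulb.
Variable b : bool.
Implicit Types s t : option (pseudoword A).

Lemma osigma_mulb s t : osigma s -> osigma t -> osigma (mulb b s t).
Proof. by case: b => ? ?; exact: osigma_mul. Qed.

Lemma oev_mulb s t : oev (mulb b s t) = mulb b (oev s) (oev t).
Proof. by case: b; rewrite /mulb oevM. Qed.

Lemma ocontent_mulb s t : ocontent (mulb b s t) = ocontent s :|: ocontent t.
Proof. by case: b; rewrite /mulb ocontent_mul // finset.setUC. Qed.

Lemma vconst_mulb u v : vconst H u -> vconst H v ->
  vconst H (fun i => mulb b (u i) (v i)).
Proof. by move=> uc vc i j; case: b; exact: veq_mul. Qed.

End Mulb.

(** The content clause ensures that replaced prefixes still lead to full content and that nonempty
    entries stay nonempty. *)
Definition reducible u := exists w, [/\ forall i, osigma (w i),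
  forall i, oev (w i) = oev (u i), vconst H w &
  forall i, ocontent (w i) = ocontent (u i)].

Definition full (B : {set A}) w := [/\ forall i, osigma (w i), vconst H w &
  forall i, ocontent (w i) = B].

Lemma full_mulb b B v w : full B v -> full B w ->
  full B (fun i => mulb b (v i) (w i)).
Proof.
move=> [sv cv vB] [sw cw wB]; split=> [i||i]; first exact: osigma_mulb.
  exact: vconst_mulb.
by rewrite ocontent_mulb vB wB finset.setUid.
Qed.

Lemma reducible_mulb b u v : reducible u -> reducible v ->
  reducible (fun i => mulb b (u i) (v i)).
Proof.
move=> [u' [su ue uc uC]] [v' [sv ve vc vC]].
exists (fun i => mulb b (u' i) (v' i)); split=> [i|i||i].
- exact: osigma_mulb.
- by rewrite !oev_mulb ue ve.
- exact: vconst_mulb.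
- by rewrite !ocontent_mulb uC vC.
Qed.

Lemma reducible_eq u v : (forall i, oev (u i) = oev (v i)) ->
  (forall i, ocontent (u i) = ocontent (v i)) -> reducible u -> reducible v.
Proof.
move=> uv uvC [w [sw we wc wC]].
by exists w; split=> // i; rewrite ?we ?wC.
Qed.

Lemma full_reducible B v : full B v -> reducible v.
Proof. by move=> [sv vc _]; exists v. Qed.

Lemma side_step b u : vconst H u -> ocontent (u i0) != finset.set0 ->
  exists x a y, [/\ vconst H x, vconst H y,
    forall i, u i = mulb b (mulb b (x i) (Some (free_gen _ a))) (y i) &
    ~~ (ocontent (u i0) \subset ocontent (x i0)) /\
    ocontent (x i0) :|: finset.set1 a = ocontent (u i0)].
Proof. by case: b; [exact: right_step|exact: left_step]. Qed.

(** A remainder of smaller content would make [u] reducible by induction. So factorization never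
    ends, and [pigeonhole_loop] applies to the tuples of values in [S]. *)
Lemma side_loop b (B : {set A}) : B != finset.set0 ->
  (forall v, vconst H v -> (#|ocontent (v i0)| < #|B|)%N -> reducible v) ->
  forall u, [/\ vconst H u, ocontent (u i0) = B & ~ reducible u] ->
  exists x y r, [/\ full B x, full B y,
    [/\ vconst H r, ocontent (r i0) = B & ~ reducible r],
    forall i, oev (u i) = mulb b (oev (x i)) (oev (r i)) &
    forall i, mulb b (oev (x i)) (oev (y i)) = oev (x i)].
Proof.
move=> B0 IH u uP.
pose e (x : I -> option (pseudoword A)) : {ffun I -> option S} :=
  [ffun i => oev (x i)].
pose op x y := fun i => mulb b (x i) (y i).
have opA : associative op.
  by move=> x y z; apply/funext => i; exact: mulbA.
have [|r rP|r g r' g' r'' rg rg' i|x [y [r [xB yB rP ur /ffunP exy]]]] :=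
  @pigeonhole_loop _ _ _ op e (full B)
    (fun r => [/\ vconst H r, ocontent (r i0) = B & ~ reducible r])
    (fun r x r' => forall i, oev (r i) = mulb b (oev (x i)) (oev (r' i)))
    opA _ _ _ u uP.
- by move=> g g'; exact: full_mulb.
- have [rc rB rN] := rP.
  have [|x [a [y [xc yc rE [nx xa]]]]] := @side_step b r rc.
    by rewrite rB.
  rewrite rB in nx xa.
  (* The prefix misses part of [B], so induction replaces it; together with the letter [a] it has
     content [B] again. *)
  have [|x' [sx' x'E x'c x'C]] := IH x xc.
    by apply: proper_card; rewrite properE nx -xa finset.subsetUl.
  pose z i := mulb b (x' i) (Some (free_gen _ a)).
  have ga : osigma (Some (free_gen _ a)) by exact: sigma_gen.
  have zB : full B z.
    split=> [i||i]; rewrite /z.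
    - exact: osigma_mulb.
    - by apply: vconst_mulb => // ? ?.
    - by rewrite ocontent_mulb x'C (vconst_content pvH i i0 xc) /= content_gen.
  have rz i : oev (r i) = mulb b (oev (z i)) (oev (y i)).
    by rewrite rE /z !oev_mulb x'E.
  exists z, y; split=> //.
  have yB : ocontent (y i0) \subset B.
    by rewrite -rB rE ocontent_mulb finset.subsetUr.
  (* A reduction of the remainder, multiplied by [z], would reduce [r]. Hence [IH] also excludes
     smaller content of [y]. *)
  have yN : ~ reducible y.
    move=> yR; apply: rN.
    apply: reducible_eq (reducible_mulb b (full_reducible zB) yR) => i.
      by rewrite rz oev_mulb.
    have [_ _ zC] := zB.
    rewrite ocontent_mulb zC (vconst_content pvH i i0 rc) rB.
    by rewrite (vconst_content pvH i i0 yc); apply/finset.setUidPl.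
  split=> //; apply/eqP; rewrite finset.eqEcard yB leqNgt; apply/negP.
  by move/(IH y yc).
- by rewrite rg rg' oev_mulb mulbA.
exists x, y, r; split=> // i.
by have := exy i; rewrite !ffunE oev_mulb.
Qed.

(** In [S], [x] absorbs the omega power of [y] and [x'] that of [y'], so inserting these powers
    changes no value. Between them, [middle_eq] asks only for a middle of constant value over [H],
    which [group_reduction] provides. *)
Lemma middle_step (B : {set A}) x y m x' y' : B != finset.set0 ->
  full B x -> full B y -> full B x' -> full B y' ->
  (forall i, oev (x i) * oev (y i) = oev (x i)) ->
  (forall i, oev (y' i) * oev (x' i) = oev (x' i)) ->
  vconst H m -> (forall i, ocontent (m i) = B) ->
  reducible (fun i => x i * m i * x' i).
Proof.
move=> B0 [sx xc xB] [sy yc yB] [sx' x'c x'B] [sy' y'c y'B] xy yx mc mB.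
have full_some u : (forall i, ocontent (u i) = B) ->
      exists u1 : I -> pseudoword A, forall i, u i = Some (u1 i).
  move=> uB.
  have /choice[u1 u1E] : forall i, exists w : pseudoword A, u i = Some w.
    move=> i; have := uB i; case: (u i) => [w _|/= e]; first by exists w.
    by rewrite -e eqxx in B0.
  by exists u1.
have [y1 y1E] := full_some y yB; have [z1 z1E] := full_some y' y'B.
have [m1 m1E] := full_some m mB.
have /finset.set0Pn[a0 a0B] := B0; pose b0 : letters B := Sub a0 a0B.
have cB i : content (m1 i) = B by rewrite -(mB i) m1E.
have [|n [ns nE nH]] := group_reduction pvH red0 (lam \o val) i0
    (r := fun i => retract b0 (m1 i)).
  (* The groups of [H] belong to [DO_inter H], so the [m i] agree in them. *)
  move=> i j G HG k; rewrite !ev_retract.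
  by have := mc i j G (DO_inter_group pvH HG) (fun a => k (insubd b0 a));
    rewrite !m1E => -[].
exists (fun i =>
  x i * Some (omega (y1 i) * of_letters (n i) * omega (z1 i)) * x' i).
have sE (w : pseudoword A) : osigma (Some w) -> osigma (Some (omega w)).
  by apply: sigma_generated_omega; right.
split=> [i|i|i j T HT l|i].
- apply: osigma_mul => //; apply: osigma_mul => //.
  rewrite -!omulSS; apply: osigma_mul; first apply: osigma_mul.
  + by apply: sE; rewrite -y1E.
  + apply: (@sigma_generated_sub _ sigma0); first by move=> ? ?; left.
    apply: sigma_generated_subst => // b; exact: sigma_gen.
  + by apply: sE; rewrite -z1E.
- have xE : oev (x i) * oev (Some (omega (y1 i))) = oev (x i).
    rewrite /oev /= ev_omega; apply: omega_absorbr.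
    by have := xy i; rewrite {1}y1E.
  have x'E : oev (Some (omega (z1 i))) * oev (x' i) = oev (x' i).
    rewrite /oev /= ev_omega; apply: omega_absorbl.
    by have := yx i; rewrite {1}z1E.
  have mE : oev (Some (of_letters (n i))) = oev (m i).
    by rewrite /oev m1E /= ev_of_letters nE retractK // cB.
  by rewrite -!omulSS !oevM !mulgA xE mE -!mulgA x'E.
- have := yc i j T HT l; rewrite !y1E => -[yE].
  have := y'c i j T HT l; rewrite !z1E => -[zE].
  rewrite !(omap_mul (ev_mul l)) (xc i j T HT l) (x'c i j T HT l) /=.
  rewrite (middle_eq l (m' := n j) HT (B := B)); last first.
  + exact: nH.
  + by have := y'B i; rewrite z1E.
  + by have := yB i; rewrite y1E.
  by rewrite !ev_mul !ev_omega yE zE.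
have yBi : content (y1 i) = B by have := yB i; rewrite y1E.
have zBi : content (z1 i) = B by have := y'B i; rewrite z1E.
rewrite !ocontent_mul mB /= !content_mul !content_omega yBi zBi.
have /finset.setUidPl -> := content_of_letters (n i).
by rewrite !finset.setUid.
Qed.

Theorem vconst_reducible u : vconst H u -> reducible u.
Proof.
move: {2}(#|ocontent (u i0)|).+1 (ltnSn #|ocontent (u i0)|) => k.
elim: k u => // k IHk u uk uc; rewrite ltnS in uk.
have [B0|B0] := eqVneq (ocontent (u i0)) finset.set0.
  (* With empty content every entry is [None], so [u] is its own reduction. *)
  exists u; split=> // i; have := vconst_content pvH i i0 uc; rewrite B0.
  by case: (u i) => [w /content_neq0|].
set B := ocontent (u i0) in B0 uk.
have IH v : vconst H v -> (#|ocontent (v i0)| < #|B|)%N -> reducible v.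
  by move=> vc vB; apply: IHk => //; exact: leq_trans vB uk.
(* Irreducibility is what keeps both factorization loops going; the right one runs on the remainder
   of the left one. *)
apply: contrapT => uN.
have [x [y [r [xB yB [rc rB rN] uE xy]]]] :=
  side_loop false B0 IH (And3 uc erefl uN).
have [x' [y' [m [x'B y'B [mc mB _] rE yx]]]] :=
  side_loop true B0 IH (And3 rc rB rN).
have mB' i : ocontent (m i) = B by rewrite (vconst_content pvH i i0 mc).
apply: uN.
apply: reducible_eq (middle_step B0 xB yB x'B y'B xy yx mc mB') => i.
  by rewrite !oevM uE rE /mulb mulgA.
have [_ _ xC] := xB; have [_ _ x'C] := x'B.
by rewrite !ocontent_mul xC x'C mB' !finset.setUid (vconst_content pvH i i0 uc).
Qed.

End Main.

Theorem theorem4p1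
    (H : semigroup_class) (pvH : pseudovariety_of_groups H)
    (sigma0 : set implicit_op) (sig0 : implicit_signature sigma0)
    (red0 : pointlike_reducible H sigma0)
    (S : finSemigroupType) (A : finType)
    (phi : {multiplicative pseudoword A -> S}) (ophi : onto_continuous phi)
    (n : nat) (s : 'I_n -> S)
    (ptl : pointlike (DO_inter H) (range s))
    (u : 'I_n -> pseudoword A) (phiu : forall i, phi (u i) = s i)
    (pru : forall i j, p_proj (DO_inter H) (u i) = p_proj (DO_inter H) (u j)) :
  exists w : 'I_n -> pseudoword A,
    [/\ forall i, sigma_generated (sigma0 `|` [set omega_op]) (w i),
        forall i, phi (w i) = s i &
        forall i j, p_proj (DO_inter H) (w i) = p_proj (DO_inter H) (w j)].
Proof.
have DOt := @DO_inter_optable_of H.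
(* The empty family is immediate; otherwise [ord0] serves as the base index. *)
case: n s ptl u phiu pru => [|n] s _ u phiu pru.
  by exists u; split=> -[].
pose lam a := phi (free_gen _ a); have phiE w : phi w = ev lam w.
  exact: hom_ev ophi.1.
have [|w [ws we wc wC]] := vconst_reducible pvH sig0 red0 lam ord0
    (u := fun i => Some (u i)).
  move=> i j T HT l; congr Some.
  by move/(p_proj_eqP _ _ DOt): (pru i j) => ->.
(* Content is preserved and that of a pseudoword is nonempty, so no entry is [None]. *)
have /choice[v vE] : forall i, exists v, w i = Some v.
  move=> i; have := wC i; case: (w i) => [v|/= /esym/content_neq0 //].
  by exists v.
exists v; split=> [i|i|i j].
- by have := ws i; rewrite vE.
- by have := we i; rewrite vE /= -!phiE phiu => -[].
- apply/(p_proj_eqP _ _ DOt) => T HT l.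
  by have := wc i j T HT l; rewrite !vE => -[].
Qed.
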